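(* Let $\kappa$ be a regular uncountable cardinal, $\lambda<\kappa$ an infinite cardinal, $\theta$ a cardinal, and $T\subseteq\kappa$ a stationary set of limit ordinals. For each $\delta\in E^\kappa_\lambda$ let $J_\delta$ be a $\lambda$-complete proper ideal over $\delta$ extending $J^{\mathrm{bd}}[\delta]$. Suppose $\vec C=\langle C_\delta\mid\delta\in E^\kappa_\lambda\rangle$ is a $\lambda$-bounded $C$-sequence such that for every club $D\subseteq\kappa$ there exists $\delta\in E^\kappa_\lambda$ with $$\{\beta<\delta\mid \min(C_\delta\setminus(\beta+1))\in D\cap T\}\in J_\delta^+.$$ Assume any one of the following: (1) $\theta=\lambda=\lambda^{<\lambda}$ and $\lambda$ is a successor cardinal; (2) $\theta=\lambda$, $\diamondsuit(\lambda)$ holds, and $\lambda$ is not Mahlo; (3) $\theta=\lambda$, $\diamondsuit^*(\lambda)$ holds, and each $J_\delta$ is normal; (4) $\theta<\lambda$ is regular, and $\lambda$ is not greatly Mahlo. Then there exists a map $h:\lambda\to\theta$ such that for every club $D\subseteq\kappa$ there exists $\delta\in E^\kappa_\lambda$ such that for every $\tau<\theta$, $$\{\beta<\delta\mid h(\mathrm{otp}(C_\delta\cap\beta))=\tau\ \&\ \min(C_\delta\setminus(\beta+1))\in D\cap T\}\in J_\delta^+.$$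
   Context: $E^\kappa_\lambda=\{\alpha<\kappa\mid\mathrm{cf}(\alpha)=\lambda\}$. A $C$-sequence over $S$ is $\langle C_\delta\mid\delta\in S\rangle$ with each $C_\delta$ a closed subset of $\delta$ with $\sup(C_\delta)=\delta$; it is $\lambda$-bounded if $\mathrm{otp}(C_\delta)\le\lambda$ for all $\delta$. $J^{\mathrm{bd}}[\delta]$ is the ideal of bounded subsets of $\delta$, and $J^+=\mathcal P(\delta)\setminus J$. $\diamondsuit(\lambda)$ and $\diamondsuit^*(\lambda)$ are Jensen's diamond and diamond-star principles; ''greatly Mahlo'' is in the sense of Baumgartner–Taylor–Wagon. *)

(* Defs.v *)
From HB Require Import structures.
From mathcomp Require Export all_boot all_order all_classical.

Set Implicit Arguments.
Unset Strict Implicit.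
Unset Printing Implicit Defensive.

Import Order.TTheory.
Local Open Scope order_scope.
Local Open Scope card_scope.
Local Open Scope classical_set_scope.

(* Ordinals are the elements of a well-ordered type O, i.e. of an arbitrary
   (nonempty, hence with least element \bot = 0) initial segment of the
   ordinals.  The statement only concerns ordinals up to some kappa : O. *)
Definition well_ordered {d : Order.disp_t} (O : bOrderType d) : Prop :=
  well_founded (fun x y : O => x < y).

(* The ordinal a as the set of its predecessors. *)
Definition pre {d : Order.disp_t} {O : bOrderType d} (a : O) : set O :=
  [set x | x < a].

(* The value is \bot on the empty set. *)
Definition omin {d : Order.disp_t} {O : bOrderType d} (A : set O) : O :=
  xget \bot [set x | A x /\ lbound A x].

Definition limit {d : Order.disp_t} {O : bOrderType d} (a : O) : Prop :=
  \bot < a /\ forall b, b < a -> exists2 c, b < c & c < a.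

Definition is_otp {d : Order.disp_t} {O : bOrderType d} (A : set O) (a : O) :
    Prop :=
  exists f : O -> O,
    f @` pre a = A /\ (forall x y, x < y -> y < a -> f x < f y).

(* Well defined on every A contained in some pre a, which is the only use. *)
Definition otp {d : Order.disp_t} {O : bOrderType d} (A : set O) : O :=
  xget \bot (is_otp A).

Definition cofinal {d : Order.disp_t} {O : bOrderType d} (a : O) (A : set O) :
    Prop :=
  A `<=` pre a /\ forall b, b < a -> exists2 c, A c & b <= c.

Definition cf {d : Order.disp_t} {O : bOrderType d} (a : O) : O :=
  omin [set b | exists2 A, cofinal a A & is_otp A b].

(* E^kappa_lambda *)
Definition Ecf {d : Order.disp_t} {O : bOrderType d} (kappa lambda : O) :
    set O :=
  [set a | a < kappa /\ cf a = lambda].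

(* Cardinals are initial ordinals. *)
Definition cardinal {d : Order.disp_t} {O : bOrderType d} (a : O) : Prop :=
  forall b, b < a -> ~ (pre a #<= pre b).

Definition infinite_cardinal {d : Order.disp_t} {O : bOrderType d} (a : O) :
    Prop :=
  cardinal a /\ infinite_set (pre a).

Definition successor_cardinal {d : Order.disp_t} {O : bOrderType d} (a : O) :
    Prop :=
  cardinal a /\ exists b, [/\ cardinal b, b < a &
    forall c, cardinal c -> b < c -> a <= c].

Definition regular {d : Order.disp_t} {O : bOrderType d} (a : O) : Prop :=
  infinite_cardinal a /\ cf a = a.

Definition regular_uncountable {d : Order.disp_t} {O : bOrderType d} (a : O) :
    Prop :=
  regular a /\ ~ countable (pre a).

(* The set of all maps from some a < lambda to lambda: such a map is coded by
   the pair of a and its extension by \bot outside of a.  Its cardinality is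
   lambda^{<lambda}. *)
Definition lt_sequences {d : Order.disp_t} {O : bOrderType d} (lambda : O) :
    set (O * (O -> O)) :=
  [set p | [/\ p.1 < lambda,
               forall x, x < p.1 -> p.2 x < lambda &
               forall x, p.1 <= x -> p.2 x = \bot]].

Definition closed_in {d : Order.disp_t} {O : bOrderType d} (a : O) (A : set O) :
    Prop :=
  forall b, \bot < b -> b < a -> supremums (A `&` pre b) b -> A b.

(* Closed subset A of a with sup A = a. *)
Definition club {d : Order.disp_t} {O : bOrderType d} (a : O) (A : set O) :
    Prop :=
  [/\ A `<=` pre a, supremums A a & closed_in a A].

Definition stationary {d : Order.disp_t} {O : bOrderType d} (a : O)
    (S : set O) : Prop :=
  S `<=` pre a /\ forall D, club a D -> S `&` D !=set0.

Definition C_sequence {d : Order.disp_t} {O : bOrderType d} (S : set O)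
    (C : O -> set O) : Prop :=
  forall a, S a -> club a (C a).

Definition bounded_C_sequence {d : Order.disp_t} {O : bOrderType d} (S : set O)
    (lambda : O) (C : O -> set O) : Prop :=
  C_sequence S C /\ forall a, S a -> otp (C a) <= lambda.

Definition ideal {d : Order.disp_t} {O : bOrderType d} (a : O)
    (J : set (set O)) : Prop :=
  [/\ forall A, J A -> A `<=` pre a,
      J set0,
      forall A B, B `<=` A -> J A -> J B &
      forall A B, J A -> J B -> J (A `|` B)].

Definition proper_ideal {d : Order.disp_t} {O : bOrderType d} (a : O)
    (J : set (set O)) : Prop :=
  ideal a J /\ ~ J (pre a).

(* Closed under unions of fewer than lambda many sets. *)
Definition complete {d : Order.disp_t} {O : bOrderType d} (lambda : O)
    (J : set (set O)) : Prop :=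
  forall F : set (set O), F `<=` J -> ~ (pre lambda #<= F) ->
    J (\bigcup_(A in F) A).

(* J^bd[a] *)
Definition Jbd {d : Order.disp_t} {O : bOrderType d} (a : O) : set (set O) :=
  [set A | A `<=` pre a /\ exists2 b, b < a & ubound A b].

(* J^+ = P(a) \ J *)
Definition positive {d : Order.disp_t} {O : bOrderType d} (a : O)
    (J : set (set O)) : set (set O) :=
  [set A | A `<=` pre a /\ ~ J A].

Definition dual_filter {d : Order.disp_t} {O : bOrderType d} (a : O)
    (J : set (set O)) : set (set O) :=
  [set A | A `<=` pre a /\ J (pre a `\` A)].

Definition regressive {d : Order.disp_t} {O : bOrderType d} (A : set O)
    (f : O -> O) : Prop :=
  forall b, A b -> f b < b.

(* Normality for ideals over a regular cardinal. *)
Definition normal_on_cardinal {d : Order.disp_t} {O : bOrderType d} (a : O)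
    (J : set (set O)) : Prop :=
  forall A f, positive a J A -> regressive A f ->
    exists c, positive a J [set b | A b /\ f b = c].

(* Normality for ideals over an arbitrary limit ordinal: a regressive function
   on a positive set is bounded on a positive subset.  If a is a regular
   cardinal and J is a-complete, this is normal_on_cardinal.  If cf a < a, no
   proper ideal extending Jbd a satisfies normal_on_cardinal, whereas Fodor's
   lemma gives the property below for the nonstationary ideal over any a of
   uncountable cofinality. *)
Definition normal {d : Order.disp_t} {O : bOrderType d} (a : O)
    (J : set (set O)) : Prop :=
  forall A f, positive a J A -> regressive A f ->
    exists2 c, c < a & positive a J [set b | A b /\ f b < c].

Definition diamond {d : Order.disp_t} {O : bOrderType d} (lambda : O) : Prop :=
  regular_uncountable lambda /\
  exists A : O -> set O,
    (forall a, a < lambda -> A a `<=` pre a) /\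
    (forall X, X `<=` pre lambda ->
      stationary lambda [set a | a < lambda /\ X `&` pre a = A a]).

Definition diamond_star {d : Order.disp_t} {O : bOrderType d} (lambda : O) :
    Prop :=
  regular_uncountable lambda /\
  exists A : O -> set (set O),
    (forall a, a < lambda ->
      (forall Y, A a Y -> Y `<=` pre a) /\ A a #<= pre a) /\
    (forall X, X `<=` pre lambda ->
      exists2 D, club lambda D & forall a, D a -> A a (X `&` pre a)).

(* The weak Mahlo hierarchy of Baumgartner, Taylor and Wagon: no strong limit
   requirement. *)
Definition Mahlo {d : Order.disp_t} {O : bOrderType d} (lambda : O) : Prop :=
  regular_uncountable lambda /\
  stationary lambda [set a | a < lambda /\ regular a].

Definition Mahlo_operation {d : Order.disp_t} {O : bOrderType d} (lambda : O)
    (X : set O) : set O :=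
  [set a | [/\ a < lambda, regular_uncountable a & stationary a (X `&` pre a)]].

Definition greatly_Mahlo {d : Order.disp_t} {O : bOrderType d} (lambda : O) :
    Prop :=
  regular_uncountable lambda /\
  exists J : set (set O),
    [/\ proper_ideal lambda J, complete lambda J, Jbd lambda `<=` J,
        normal_on_cardinal lambda J &
        forall X, dual_filter lambda J X ->
          dual_filter lambda J (Mahlo_operation lambda X)].

(* Main.v *)
Require Import Defs.
From mathcomp Require Import all_boot all_order all_classical.

(* If [delta] guesses a club [D], the map [beta |-> otp (C delta `&` pre beta)]
   sends [J delta], restricted to the guessed set, to a [lambda]-complete proper
   ideal [I] over [lambda] containing the bounded sets.  So it suffices to find
   few (small for [kappa]) colourings [c p] of [lambda] such that for every such
   [I] some [c p] has all its fibres [I]-positive: if every [c p] failed with a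
   club [D p], the intersection of the [D p] would give a contradiction.

   (1) For [lambda = mu^+] the candidates for the tuple of omitted colours of
   [c i], [i < mu], are enumerated in type [lambda] and diagonalized against.
   (2), (3) The guesses of the diamond sequences are used in the same way.  In
   (3) the omitted colours are guessed at [x] itself; in (2) they are guessed at
   an ordinal reached from [x] in finitely many steps, which is positively often
   a given point of a club of singular ordinals.
   (4) If [lambda] is not greatly Mahlo, there is a C-sequence on [lambda] that
   no club threads, and its walks provide a map of [lambda] to itself with
   unboundedly many [I]-positive fibres.  It is composed with maps
   [g : lambda -> theta], few of them, such that every unbounded set is mapped
   onto [theta] by some [g]; these come from club guessing, combined with walks
   when [lambda = theta^+], and from an oscillation argument when moreover
   [theta] is countable. *)

Set Implicit Arguments.
Unset Strict Implicit.
Unset Printing Implicit Defensive.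

Import Order.TTheory.
Local Open Scope order_scope.
Local Open Scope card_scope.
Local Open Scope classical_set_scope.

(** The colouring must be fixed before [D] and [delta] are known, so only completeness of [I] and
    the bounded sets in it may be used (and weak normality in (3)). In particular a nonstationary
    subset of [lambda] may be [I]-positive. This is the obstacle in (2): the points at which the
    diamond sequence guesses correctly form a stationary set that may belong to [I]. So one correct
    point is fixed, and all larger ordinals are steered to it with labels below that point, where
    completeness applies. In (4) nothing is known about which fibres of the walk are positive, so
    the maps [g] have to treat arbitrary unbounded sets. Club guessing iterates along a length below
    [lambda] for which the guessed sets are small; guesses of type [theta] therefore need a cardinal
    strictly between [theta] and [lambda]. If there is none, only guesses of type below [theta] are
    available, and walks assemble them into a map onto [theta]. That assembly bounds countably many
    colours below [theta], which is why countable [theta] needs its own argument. *)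

(** * Order reasoning, well-founded recursion and comparison of cardinalities *)

Lemma notle_lt (d : Order.disp_t) (O : orderType d) (x y : O) :
  ~ (x <= y) -> y < x.
Proof. by move/negP; rewrite leNgt negbK. Qed.

Lemma notlt_le (d : Order.disp_t) (O : orderType d) (x y : O) :
  ~ (x < y) -> y <= x.
Proof. by move/negP; rewrite ltNge negbK. Qed.

Lemma neg_le (d : Order.disp_t) (O : orderType d) (x y : O) :
  (y < x -> False) -> x <= y.
Proof. by move=> h; apply: notlt_le. Qed.

Lemma neg_lt (d : Order.disp_t) (O : orderType d) (x y : O) :
  (y <= x -> False) -> x < y.
Proof. by move=> h; apply: notle_lt. Qed.

Lemma neg_neq (d : Order.disp_t) (O : orderType d) (x y : O) :
  (x < y -> False) -> (y < x -> False) -> x = y.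
Proof. by move=> h k; case: (ltgtP x y). Qed.

Lemma eq_le (d : Order.disp_t) (O : orderType d) (x y : O) : x = y -> x <= y.
Proof. by move=> ->. Qed.

(* Decides goals that follow from the order hypotheses by transitivity. *)
Ltac ord_hyp T prf :=
  lazymatch goal with
  | _ : T |- _ => fail
  | _ => have ? : T := prf
  end.
Ltac ord_step :=
  match goal with
  | H : is_true (?x < ?x) |- _ => by rewrite ltxx in H
  | H : is_true (?x < ?y), K : is_true (?y < ?z) |- _ =>
      ord_hyp (is_true (x < z)) (lt_trans H K)
  | H : is_true (?x < ?y), K : is_true (?y <= ?z) |- _ =>
      ord_hyp (is_true (x < z)) (lt_le_trans H K)
  | H : is_true (?x <= ?y), K : is_true (?y < ?z) |- _ =>
      ord_hyp (is_true (x < z)) (le_lt_trans H K)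
  | H : is_true (?x <= ?y), K : is_true (?y <= ?z) |- _ =>
      ord_hyp (is_true (x <= z)) (le_trans H K)
  end.
Ltac ord_eq :=
  match goal with
  | H : ?x = ?y |- _ =>
      first [ord_hyp (is_true (x <= y)) (eq_le H) |
             ord_hyp (is_true (y <= x)) (eq_le (esym H))]
  end.
Ltac ord_pre :=
  match goal with
  | H : ~ is_true (_ < _) |- _ => move/notlt_le: H => H
  | H : ~ is_true (_ <= _) |- _ => move/notle_lt: H => H
  | H : is_true (~~ (_ < _)) |- _ => rewrite -leNgt in H
  | H : is_true (~~ (_ <= _)) |- _ => rewrite -ltNge in H
  | H : is_true (_ && _) |- _ => case/andP: H => ? ?
  end.
Ltac ord :=
  intros;
  try match goal with |- ~ _ => move=> ? end;
  try match goal with |- is_true (_ && _) => apply/andP; split end;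
  lazymatch goal with
  | |- is_true (_ < _) => apply: neg_lt => ?
  | |- is_true (_ <= _) => apply: neg_le => ?
  | |- _ = _ => apply: neg_neq => ?
  | _ => idtac
  end;
  repeat ord_pre; repeat ord_eq; repeat ord_step.

(** [G] is given a total function, which avoids dependent types; the second hypothesis says that
    [G x] consults it only below [x]. *)
Lemma wf_rec (T U : Type) (u0 : U) (R : T -> T -> Prop)
    (G : T -> (T -> U) -> U) :
  well_founded R ->
  (forall x f g, (forall y, R y x -> f y = g y) -> G x f = G x g) ->
  exists F : T -> U, forall x, F x = G x F.
Proof.
move=> wfR Gext.
pose step x (rec : forall y, R y x -> U) : U :=
  G x (fun y => if pselect (R y x) is left h then rec y h else u0).
exists (Fix wfR (fun=> U) step) => x.
rewrite Fix_eq => [|y f g fg]; last first.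
  by apply: Gext => z Rzy; case: pselect.
by apply: Gext => y Ryx; case: pselect.
Qed.

Lemma card_le_inj (T U : Type) (A : set T) (B : set U) (f : T -> U) :
  (forall x, A x -> B (f x)) ->
  (forall x y, A x -> A y -> f x = f y -> x = y) -> A #<= B.
Proof.
move=> fAB finj.
apply: (@card_le_trans _ _ _ (f @` A)); last first.
  by apply: subset_card_le => _ [x Ax <-]; exact: fAB.
have : f @` A #= A.
  by apply: inj_card_eq => x y; rewrite !inE => Ax Ay; exact: finj.
by rewrite card_eq_sym card_eq_le => /andP[].
Qed.

Lemma card_le_surj (T U : Type) (A : set T) (B : set U) (f : U -> T) :
  (forall x, A x -> exists2 y, B y & f y = x) -> A #<= B.
Proof.
move=> fsurj; apply: (@card_le_trans _ _ _ (f @` B)); last first.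
  exact: card_image_le.
by apply: subset_card_le => x /fsurj[y By <-]; exists y.
Qed.

Lemma card_leI (T U : Type) (u0 : U) (A : set T) (B : set U) : A #<= B ->
  exists f : T -> U, (forall x, A x -> B (f x)) /\
    (forall x y, A x -> A y -> f x = f y -> x = y).
Proof.
move=> /card_leP[f].
exists (fun x => if pselect (A x) is left h then \val (f (SigSub (mem_set h)))
                 else u0).
split=> [x Ax|x y Ax Ay].
  case: pselect => // h.
  by have /set_mem := valP (f (SigSub (mem_set h))).
case: pselect => // hx; case: pselect => // hy /val_inj fxy.
have := @inj _ _ _ f (SigSub (mem_set hx)) (SigSub (mem_set hy)).
by rewrite !in_setT => /(_ isT isT fxy) [].
Qed.

Lemma card_leS (T U : Type) (t0 : T) (A : set T) (B : set U) : A #<= B ->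
  exists f : U -> T, forall x, A x -> exists2 y, B y & f y = x.
Proof.
move=> AB; have [[x0 Ax0]|A0] := pselect (A !=set0); last first.
  by exists (fun=> t0) => x Ax; case: A0; exists x.
have [[y0 By0]|B0] := pselect (B !=set0); last first.
  have B_0 : B = set0.
    by apply/seteqP; split => // y By; case: B0; exists y.
  by move: AB; rewrite B_0 card_le0 => /eqP A_0; rewrite A_0 in Ax0.
have [f [fAB finj]] := card_leI y0 AB.
pose Q (y : U) (x : T) := (A x /\ f x = y) \/ (~ (exists x', A x' /\ f x' = y)).
have /boolp.choice[g gP] : forall y, exists x, Q y x.
  move=> y; have [[x hx]|no] := pselect (exists x', A x' /\ f x' = y).
    by exists x; left.
  by exists t0; right.
exists g => x Ax; exists (f x); first exact: fAB.
by case: (gP (f x)) => [[Ag fg]|no]; [exact: finj | case: no; exists x].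
Qed.

(** * Ordinals *)

Section Ordinals.
Variables (d : Order.disp_t) (O : bOrderType d).
Hypothesis wfO : well_ordered O.
Implicit Types (a b c x y z : O) (A B D X : set O).

Lemma ord_ind (P : O -> Prop) :
  (forall x, (forall y, y < x -> P y) -> P x) -> forall x, P x.
Proof. exact: (well_founded_ind wfO). Qed.

Lemma omin_spec A : A !=set0 -> A (omin A) /\ forall x, A x -> omin A <= x.
Proof.
move=> [x0 Ax0].
suff [m [Am mP]] : exists m, A m /\ lbound A m.
  by rewrite /omin; case: xgetP => [x -> []|/(_ m)[]].
elim/ord_ind: x0 Ax0 => x IH Ax.
have [mP|/existsNP[y /not_implyP[Ay]]] := pselect (lbound A x); first by exists x.
by move=> /notle_lt /IH; exact.
Qed.

Lemma omin_in A x : A x -> A (omin A).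
Proof. by move=> Ax; have [] := @omin_spec A (ex_intro _ x Ax). Qed.

Lemma omin_le A x : A x -> omin A <= x.
Proof. by move=> Ax; have [_] := @omin_spec A (ex_intro _ x Ax); exact. Qed.

(** If nothing lies above [x], the value is [\bot]; hence the lemmas about it ask for an element
    above. *)
Definition osucc x : O := omin [set y | x < y].

Lemma osucc_gt x y : x < y -> x < osucc x.
Proof. by move=> xy; have := @omin_in [set y | x < y] y xy. Qed.

Lemma osucc_le x y : x < y -> osucc x <= y.
Proof. by move=> xy; have := @omin_le [set y | x < y] y xy. Qed.

Lemma le_osucc x y z : y < z -> x < osucc y -> x <= y.
Proof.
move=> yz xs; apply: neg_le => yx.
by have := osucc_le yx; ord.
Qed.

Lemma limit_osucc a x : limit a -> x < a -> osucc x < a.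
Proof. by move=> [_ lim] /lim[y xy ya]; have := osucc_le xy; ord. Qed.

(** A last element [b] could be absorbed by a countable part of [pre b], so [pre a] would inject
    into [pre b]. *)
Lemma infinite_cardinal_limit a : infinite_cardinal a -> limit a.
Proof.
move=> [ca ia]; split.
  rewrite lt0x; apply/eqP => a0; apply: ia.
  by rewrite (_ : pre a = set0)//; apply/seteqP; split => // x; rewrite /pre/= a0 ltx0.
move=> b ba; apply: contrapT => no.
have leb x : x < a -> x <= b.
  by move=> xa; apply: neg_le => bx; apply: no; exists x.
have ib : infinite_set (pre b).
  move=> fb; apply: ia.
  apply: (@sub_finite_set _ _ (pre b `|` [set b])).
    move=> x /leb; rewrite le_eqVlt => /orP[/eqP ->|]; first by right.
    by left.
  by rewrite finite_setU; split=> //; exact: finite_set1.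
have /infiniteP /(card_leI \bot)[f [fb finj]] := ib.
have {finj} finj i j : f i = f j -> i = j by exact: finj.
(* Shift along the copy [f] of the natural numbers to make room for [b]. *)
pose Q x y := (exists n, x = f n /\ y = f n.+1) \/
              ((forall n, x <> f n) /\ y = if x == b then f 0%N else x).
have /boolp.choice[g gP] : forall x, exists y, Q x y.
  move=> x; have [[n xn]|no'] := pselect (exists n, x = f n).
    by exists (f n.+1); left; exists n.
  by eexists; right; split; [move=> n xn; apply: no'; exists n|].
apply: (ca b ba); apply: (@card_le_inj _ _ _ _ g).
- move=> x xa; case: (gP x) => [[n [_ ->]]|[_ ->]]; first exact: fb.
  case: eqVneq => [_|xb]; first exact: fb.
  by rewrite /pre/= lt_neqAle xb leb.
- move=> x y xa ya.
  case: (gP x) => [[n [-> ->]]|[xn ->]]; case: (gP y) => [[m [-> ->]]|[ym ->]].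
  + by move=> /finj[->].
  + case: eqVneq => [_ /finj//|_ h].
    by case: (ym n.+1).
  + case: eqVneq => [_ /finj//|_ h].
    by case: (xn m.+1).
  + case: eqVneq => [->|xb]; case: eqVneq => [->|yb] // h.
    * by case: (ym 0%N).
    * by case: (xn 0%N).
Qed.

(** [g] is the Mostowski collapse: it stays below the identity, is increasing on [A], and maps [A]
    onto an initial segment. Its inverse enumerates [A]. *)
Lemma otp_exists A a : A `<=` pre a -> exists2 b, b <= a & is_otp A b.
Proof.
move=> Aa.
have [|g gE] := @wf_rec _ _ \bot _
  (fun x (g : O -> O) => omin [set z | forall y, A y -> y < x -> g y < z]) wfO.
  by move=> x f g fg; congr omin; apply/seteqP; split => z h y Ay yx /=;
    [rewrite -fg //|rewrite fg //]; exact: h.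
have gle x : g x <= x.
  elim/ord_ind: x => x IH; rewrite gE; apply: omin_le => y Ay yx /=.
  by have := IH y yx; ord.
have gmono x y : A y -> y < x -> g y < g x.
  move=> Ay yx; have : [set z | forall y, A y -> y < x -> g y < z] (g x).
    rewrite [g x]gE; apply: (@omin_in _ x) => z Az zx.
    by have := gle z; ord.
  exact.
have gdown x z : A x -> z <= g x -> exists2 y, A y & g y = z.
  elim/ord_ind: x z => x IH z Ax zx.
  have [zg|zg] := leP (g x) z; first by exists x => //; ord.
  have /existsNP[y /not_implyP[Ay /not_implyP[yx /notlt_le zy]]] :
      ~ (forall y, A y -> y < x -> g y < z).
    by move=> h; move: zg; rewrite gE ltNge omin_le.
  exact: (IH y).
pose b := omin [set z | forall x, A x -> g x < z].
have bin : [set z | forall x, A x -> g x < z] a.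
  by move=> x Ax /=; have := gle x; have := Aa x Ax; rewrite /pre/=; ord.
have bP : forall x, A x -> g x < b by exact: (omin_in bin).
exists b; first exact: omin_le.
have /boolp.choice[f fP] : forall z, exists x, z < b -> A x /\ g x = z.
  move=> z; have [zb|bz] := ltP z b; last by exists z; ord.
  have /existsNP[x /not_implyP[Ax /notlt_le zx]] : ~ (forall x, A x -> g x < z).
    by move=> h; move: zb; rewrite ltNge omin_le.
  by have [y Ay gy] := gdown x z Ax zx; exists y.
exists f; split.
  apply/seteqP; split=> [_ [z zb <-]|x Ax]; first by have [] := fP z zb.
  exists (g x); first exact: bP.
  have [Af gf] := fP _ (bP x Ax).
  apply: neg_neq => h.
    by have := gmono _ _ Af h; ord.
  by have := gmono _ _ Ax h; ord.
move=> x y xy yb; have [Ax gx] := fP x (lt_trans xy yb); have [Ay gy] := fP y yb.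
apply: neg_lt; rewrite le_eqVlt => /orP[/eqP fyx|h].
  by rewrite fyx gx in gy; ord.
by have := gmono _ _ Ay h; rewrite gx gy; ord.
Qed.

Lemma incr_ge (f : O -> O) b :
  (forall x y, x < y -> y < b -> f x < f y) -> forall x, x < b -> x <= f x.
Proof.
move=> fm; elim/ord_ind => x IH xb; apply: neg_le => fx.
by have := IH (f x) fx (lt_trans fx xb); have := fm _ _ fx xb; ord.
Qed.

Lemma incr_inj (f : O -> O) b : (forall x y, x < y -> y < b -> f x < f y) ->
  forall x y, x < b -> y < b -> f x = f y -> x = y.
Proof.
move=> fm x y xb yb fxy; apply: neg_neq => h.
  by have := fm _ _ h yb; rewrite fxy ltxx.
by have := fm _ _ h xb; rewrite fxy ltxx.
Qed.

Lemma incr_refl (f : O -> O) b : (forall x y, x < y -> y < b -> f x < f y) ->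
  forall x y, x < b -> y < b -> f x < f y -> x < y.
Proof.
move=> fm x y xb yb fxy; apply: neg_lt; rewrite le_eqVlt => /orP[/eqP yx|h].
  by rewrite yx ltxx in fxy.
by have := fm _ _ h xb; ord.
Qed.

Lemma is_otp_uniq A b b' : is_otp A b -> is_otp A b' -> b = b'.
Proof.
suff le c c' : is_otp A c -> is_otp A c' -> c <= c'.
  by move=> h h'; apply: le_anti; rewrite !le.
move=> [f [fA fm]] [f' [f'A f'm]]; apply: neg_le => c'c.
have /boolp.choice[h hP] : forall x, exists y, x < c -> y < c' /\ f' y = f x.
  move=> x; have [xc|cx] := ltP x c; last by exists x; ord.
  have : A (f x) by rewrite -fA; exists x.
  by rewrite -f'A => -[y yc' <-]; exists y.
have hm x y : x < y -> y < c -> h x < h y.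
  move=> xy yc; have [hx fx] := hP x (lt_trans xy yc); have [hy fy] := hP y yc.
  by apply: (incr_refl f'm) => //; rewrite fx fy fm.
have := incr_ge hm c'c; have [] := hP c' c'c; ord.
Qed.

Lemma otpE A b : is_otp A b -> otp A = b.
Proof.
by move=> h; rewrite /otp; apply: xget_unique => // c hc; exact: is_otp_uniq hc h.
Qed.

Lemma cf_le a A b : cofinal a A -> is_otp A b -> cf a <= b.
Proof. by move=> cA oA; apply: omin_le; exists A. Qed.

Lemma cf_ex a : exists2 A, cofinal a A & is_otp A (cf a).
Proof.
apply: (@omin_in [set b | exists2 A, cofinal a A & is_otp A b] a).
exists (pre a); first by split => // b ba; exists b.
by exists id; split => //; rewrite image_id.
Qed.

Lemma cf_le_id a : cf a <= a.
Proof.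
apply: (@cf_le _ (pre a)); first by split => // b ba; exists b.
by exists id; split => //; rewrite image_id.
Qed.

Lemma cofinal_card a A : cofinal a A -> pre (cf a) #<= A.
Proof.
move=> cA; have [b _ oA] := otp_exists cA.1.
have ab := cf_le cA oA; case: oA => f [fA fm].
apply: (@card_le_inj _ _ _ _ f).
  by move=> x xa; rewrite -fA; exists x => //; rewrite /pre/= in xa *; ord.
by move=> x y; rewrite /pre/= => xa ya; apply: (incr_inj fm); ord.
Qed.

(* For regular [a] this means that [W] has fewer than [a] elements, in a form
   that is closed under products without cardinal arithmetic. *)
Definition small (T : Type) a (W : set T) : Prop :=
  forall f : T -> O, (forall p, W p -> f p < a) ->
    exists2 b, b < a & forall p, W p -> f p <= b.

Lemma small_card (T : Type) a (W : set T) :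
  cf a = a -> ~ (pre a #<= W) -> small a W.
Proof.
move=> cfa aW f fa; apply: contrapT => no; apply: aW.
apply: (@card_le_trans _ _ _ (f @` W)); last exact: card_image_le.
rewrite -[in pre a]cfa; apply: cofinal_card; split; first by move=> _ [p Wp <-]; exact: fa.
move=> b ba; apply: contrapT => no'; apply: no; exists b => // p Wp.
apply: neg_le => bf; apply: no'; exists (f p); first by exists p.
exact: ltW.
Qed.

Lemma small_pre a b : regular a -> b < a -> small a (pre b).
Proof. by move=> [[ca _] cfa] ba; apply: small_card => //; exact: ca. Qed.

Lemma small_nat a : regular_uncountable a -> small a [set: nat].
Proof. by move=> [[_ cfa] ua]; apply: small_card. Qed.

Lemma small_prod (T U : Type) a (W : set T) (V : set U) :
  small a W -> small a V -> small a (W `*` V).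
Proof.
move=> sW sV f fa.
have /boolp.choice[g gP] : forall p, exists b, W p ->
    b < a /\ forall q, V q -> f (p, q) <= b.
  move=> p; have [Wp|nW] := pselect (W p); last by exists \bot.
  have [|b ba bP] := sV (fun q => f (p, q)); first by move=> q Vq; exact: fa.
  by exists b.
have [|b ba bP] := sW g; first by move=> p /gP[].
exists b => // -[p q] [/= Wp Vq].
by have [_ /(_ q Vq)] := gP p Wp; have := bP p Wp; ord.
Qed.

Lemma small_image (T U : Type) a (W : set T) (g : T -> U) :
  small a W -> small a (g @` W).
Proof.
move=> sW f fa; have [|b ba bP] := sW (f \o g); first by move=> p Wp; apply: fa; exists p.
by exists b => // _ [p Wp <-]; exact: bP.
Qed.

Lemma small_bigcup (T U : Type) a (W : set T) (V : T -> set U) :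
  small a W -> (forall p, W p -> small a (V p)) -> small a (\bigcup_(p in W) V p).
Proof.
move=> sW sV f fa.
have /boolp.choice[g gP] : forall p, exists b, W p ->
    b < a /\ forall q, V p q -> f q <= b.
  move=> p; have [Wp|nW] := pselect (W p); last by exists \bot.
  have [|b ba bP] := sV p Wp f; first by move=> q Vq; apply: fa; exists p.
  by exists b.
have [|b ba bP] := sW g; first by move=> p /gP[].
exists b => // q [p Wp Vq].
by have [_ /(_ q Vq)] := gP p Wp; have := bP p Wp; ord.
Qed.

Lemma small_bool a : small a [set: bool].
Proof.
move=> f fa; exists (Order.max (f true) (f false)); first by rewrite gt_max !fa.
by move=> [] _; rewrite le_max lexx ?orbT.
Qed.

Lemma small_sub (T : Type) a (W V : set T) : W `<=` V -> \bot < a ->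
  small a V -> small a W.
Proof.
move=> WV a0 sV f fa.
have [p Vp|b ba bP] := sV (fun p => if pselect (W p) is left _ then f p else \bot).
  by case: pselect => // Wp; exact: fa.
exists b => // p Wp; have := bP p (WV p Wp).
by case: pselect.
Qed.

Lemma small_words (T : choiceType) a (W : set T) : regular_uncountable a -> small a W ->
  small a [set s : seq T | forall x : T, x \in s -> W x].
Proof.
move=> ra sW.
have a0 : \bot < a by have [] := infinite_cardinal_limit ra.1.1.
have sn n : small a [set s : seq T | size s = n /\ forall x : T, x \in s -> W x].
  elim: n => [|n IH].
    move=> f fa; exists (f [::]); first by apply: fa; split.
    by move=> [|x s] // [].
  apply: (@small_sub _ _ _ ((fun p => p.1 :: p.2) @`
      (W `*` [set s : seq T | size s = n /\ forall x : T, x \in s -> W x]))) => //.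
    move=> [|x s] [] //= [sz] h; exists (x, s) => //; split => /=.
      by apply: h; rewrite inE eqxx.
    by split=> // y ys; apply: h; rewrite inE ys orbT.
  exact/small_image/small_prod.
apply: (@small_sub _ _ _ (\bigcup_(n in [set: nat])
   [set s : seq T | size s = n /\ forall x : T, x \in s -> W x])) => //.
  by move=> s Ws; exists (size s).
by apply: small_bigcup => //; exact: small_nat.
Qed.

End Ordinals.

(** * Clubs and stationary sets *)

Section Clubs.
Variables (d : Order.disp_t) (O : bOrderType d).
Hypothesis wfO : well_ordered O.
Implicit Types (a b c x y z : O) (A B D S X : set O).

Lemma mk_club a D : D `<=` pre a -> (forall x, x < a -> exists2 y, D y & x < y) ->
  (forall z, \bot < z -> z < a ->
     (forall x, x < z -> exists2 y, D y & x < y < z) -> D z) -> club a D.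
Proof.
move=> Da Du Dc; split => //.
  split=> [y /Da|u uD]; first exact: ltW.
  by apply: neg_le => /Du[y /uD]; ord.
move=> b b0 ba [_ lb]; apply: Dc => // x xb; apply: contrapT => no.
suff /lb : ubound (D `&` pre b) x by ord.
move=> y [Dy yb]; apply: neg_le => xy; apply: no; exists y => //.
by rewrite xy.
Qed.

Lemma club_lt a D x : club a D -> D x -> x < a.
Proof. by case=> + _ _; exact. Qed.

Lemma club_unb a D x : club a D -> x < a -> exists2 y, D y & x < y.
Proof.
move=> [Da [_ lb] _] xa; apply: contrapT => no.
suff /lb : ubound D x by ord.
by move=> y Dy; apply: neg_le => xy; apply: no; exists y.
Qed.

Lemma club_closed a D z : club a D -> \bot < z -> z < a ->
  (forall x, x < z -> exists2 y, D y & x < y < z) -> D z.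
Proof.
move=> [_ _ cl] z0 za h; apply: cl => //; split=> [y [_]|u uD]; first exact: ltW.
apply: neg_le => /h[y Dy /andP[uy yz]].
have : y <= u by apply: uD; split.
by ord.
Qed.

Section RegularUncountable.
Variable a : O.
Hypothesis ra : regular_uncountable a.

Lemma regular_limit : limit a.
Proof. exact: (infinite_cardinal_limit ra.1.1). Qed.

Lemma regular_bot : \bot < a.
Proof. by case: regular_limit. Qed.

Lemma nat_lim (f : nat -> O) : (forall n, f n < a) -> (forall n, f n < f n.+1) ->
  exists z, [/\ z < a, limit z, forall n, f n < z & forall x, x < z -> exists n, x < f n].
Proof.
move=> fa fm; have [|b ba bP] := small_nat wfO ra (f := f); first by move=> n _; exact: fa.
pose Z := [set z | forall n, f n <= z].
have Zb : Z b by move=> n; exact: bP.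
have Zz : Z (omin Z) by exact: (omin_in wfO Zb).
have zb : omin Z <= b by exact: (omin_le wfO Zb).
have cofz x : x < omin Z -> exists n, x < f n.
  move=> xz; apply: contrapT => no.
  suff /(omin_le wfO) : Z x by ord.
  by move=> n; apply: neg_le => xf; apply: no; exists n.
have ltz n : f n < omin Z by have := fm n; have := Zz n.+1; ord.
exists (omin Z); split => //; first by ord.
split=> [|b' b'z]; first by have := ltz 0%N; have := le0x (f 0%N); ord.
by have [n h] := cofz _ b'z; exists (f n).
Qed.

(** The closing-off argument behind the unboundedness of the clubs below: iterate countably often
    and take the supremum. [Q] records what is achieved between consecutive stages. *)
Lemma closing (Q : O -> O -> Prop) x0 : x0 < a ->
  (forall x, x < a -> exists y, [/\ y < a, x < y & Q x y]) ->
  exists z, [/\ z < a, x0 < z, limit z &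
    forall x, x < z -> exists u v, [/\ x < u, u < v, v < z & Q u v]].
Proof.
move=> x0a Qex.
have /boolp.choice[g gP] : forall x, exists y, x < a -> [/\ y < a, x < y & Q x y].
  by move=> x; have [/Qex[y]|] := ltP x a; [exists y|exists x; ord].
pose f n := iter n g x0.
have fa n : f n < a by elim: n => //= n /gP[].
have fm n : f n < f n.+1 by have [] := gP _ (fa n).
have [z [za lz fz cz]] := nat_lim fa fm.
exists z; split => //; first exact: (fz 0%N).
move=> x /cz[n xn]; exists (f n), (f n.+1); split=> //.
by have [] := gP _ (fa n).
Qed.

Lemma club_small_bigcap (T : Type) (W : set T) (D : T -> set O) :
  small a W -> (forall p, W p -> club a (D p)) ->
  club a (pre a `&` \bigcap_(p in W) D p).
Proof.
move=> sW cD; apply: mk_club; first by move=> x [].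
  move=> x0 x0a.
  have [x xa|z [za x0z [z0 _] zQ]] := @closing (fun x y => forall p, W p -> exists2 w, D p w & x < w <= y) x0 x0a.
    have /boolp.choice[w wP] : forall p, exists w, W p -> D p w /\ x < w.
      move=> p; have [Wp|] := pselect (W p); last by exists \bot.
      by have [w] := club_unb (cD p Wp) xa; exists w.
    have [|b ba bP] := sW w; first by move=> p Wp; have [/(club_lt (cD p Wp))] := wP p Wp.
    have m : osucc x < a by exact: (limit_osucc wfO regular_limit).
    have xs := osucc_gt wfO xa.
    exists (Order.max (osucc x) b); split; first by rewrite gt_max m ba.
      by rewrite lt_max xs.
    move=> p Wp; exists (w p); first by have [] := wP p Wp.
    by rewrite le_max bP// orbT andbT; have [] := wP p Wp.
  exists z => //; split=> // p Wp; apply: (club_closed (cD p Wp)) => // x /zQ[u [v [xu uv vz]]].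
  by move=> /(_ p Wp)[w Dw /andP[uw wv]]; exists w => //; ord.
move=> z z0 za h; split=> // p Wp; apply: (club_closed (cD p Wp)) => // x /h[y [_ yD] xyz].
by exists y => //; exact: yD.
Qed.

Lemma club_diag (D : O -> set O) : (forall x, x < a -> club a (D x)) ->
  club a [set z | z < a /\ forall x, x < z -> D x z].
Proof.
move=> cD; apply: mk_club; first by move=> x [].
  move=> x0 x0a.
  have [x xa|z [za x0z [z0 _] zQ]] := @closing (fun x y => forall p, p <= x -> exists2 w, D p w & x < w <= y) x0 x0a.
    have xs := osucc_gt wfO xa.
    have m : osucc x < a by exact: (limit_osucc wfO regular_limit).
    have lea p : p < osucc x -> p < a by move=> ?; ord.
    have /boolp.choice[w wP] : forall p, exists w, p < osucc x -> D p w /\ x < w.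
      move=> p; have [Wp|] := pselect (p < osucc x); last by exists \bot.
      by have [w] := club_unb (cD p (lea _ Wp)) xa; exists w.
    have [|b ba bP] := small_pre wfO ra.1 m (f := w).
      by move=> p Wp; have [/(club_lt (cD p (lea _ Wp)))] := wP p Wp.
    exists (Order.max (osucc x) b); split; first by rewrite gt_max m ba.
      by rewrite lt_max xs.
    move=> p px; have ps : p < osucc x by ord.
    exists (w p); first by have [] := wP p ps.
    by rewrite le_max bP// orbT andbT; have [] := wP p ps.
  exists z => //; split=> // p pz; apply: (club_closed (cD p _)) => //; first by ord.
  move=> x xz; have [|u [v [xu uv vz]]] := zQ (Order.max x p); first by rewrite gt_max xz.
  have [xu' pu] : x < u /\ p < u by move: xu; rewrite gt_max => /andP.
  by move=> /(_ p (ltW pu))[w Dw /andP[uw wv]]; exists w => //; ord.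
move=> z z0 za h; split=> // x xz; apply: (club_closed (cD x _)) => //; first by ord.
move=> y yz; have [|w [_ wD]] := h (Order.max x y); first by rewrite gt_max xz.
rewrite gt_max => /andP[/andP[xw yw] wz]; exists w; first exact: wD.
by rewrite yw.
Qed.

Lemma club_limit : club a [set z | z < a /\ limit z].
Proof.
apply: mk_club; first by move=> x [].
  move=> x0 x0a; have [x xa|z [za x0z lz _]] := @closing (fun _ _ => True) x0 x0a.
    exists (osucc x); split => //; first exact: (limit_osucc wfO regular_limit).
    exact: (osucc_gt wfO xa).
  by exists z.
move=> z z0 za h; split=> //; split=> // b /h[y _ /andP[? ?]]; by exists y.
Qed.

Lemma club_gt b : b < a -> club a [set z | z < a /\ b < z].
Proof.
move=> ba; apply: mk_club; first by move=> x [].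
  move=> x xa; have m : Order.max x b < a by rewrite gt_max xa.
  exists (osucc (Order.max x b)).
    split; first exact: (limit_osucc wfO regular_limit).
    by have := osucc_gt wfO m; rewrite gt_max => /andP[].
  by have := osucc_gt wfO m; rewrite gt_max => /andP[].
by move=> z z0 za h; split=> //; have [y [_ by_] /andP[_ yz]] := h _ z0; ord.
Qed.

Lemma club_acc X : (forall x, x < a -> exists2 y, X y & x < y < a) ->
  club a [set z | [/\ z < a, \bot < z & forall x, x < z -> exists2 y, X y & x < y < z]].
Proof.
move=> Xu; apply: mk_club; first by move=> x [].
  move=> x0 x0a; have [x xa|z [za x0z lz zQ]] := @closing (fun x y => exists2 w, X w & x < w <= y) x0 x0a.
    have [w Xw /andP[xw wa]] := Xu x xa; exists w; split=> //.
    by exists w => //; rewrite xw lexx.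
  exists z => //; split=> //; first by case: lz.
  by move=> x /zQ[u [v [xu uv vz [w Xw /andP[uw wv]]]]]; exists w => //; ord.
move=> z z0 za h; split=> // x xz; have [y [ya _ yX] /andP[xy yz]] := h x xz.
by have [w Xw /andP[xw wy]] := yX x xy; exists w => //; ord.
Qed.

(** The club filter and its positive sets. Unlike [club] and [stationary], neither demands inclusion
    in [pre a], so both pass to arbitrary supersets. *)
Definition cubf A : Prop := exists2 D, club a D & D `<=` A.
Definition stat S : Prop := forall D, club a D -> exists2 x, S x & D x.

Lemma cubf_club D : club a D -> cubf D.
Proof. by exists D. Qed.

Lemma cubf_sub A B : A `<=` B -> cubf A -> cubf B.
Proof. by move=> AB [D cD DA]; exists D => // x /DA /AB. Qed.

Lemma cubf_bigcap (T : Type) (W : set T) (A : T -> set O) :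
  small a W -> (forall p, W p -> cubf (A p)) ->
  cubf [set x | x < a /\ forall p, W p -> A p x].
Proof.
move=> sW cA.
have /boolp.choice[D DP] : forall p, exists D, W p -> club a D /\ D `<=` A p.
  move=> p; have [/cA[D cD DA]|nW] := pselect (W p); last by exists set0.
  by exists D.
exists (pre a `&` \bigcap_(p in W) D p).
  by apply: club_small_bigcap => // p /DP[].
by move=> x [xa xD]; split=> // p Wp; have [_] := DP p Wp; apply; exact: xD.
Qed.

Lemma cubfI A B : cubf A -> cubf B -> cubf (A `&` B).
Proof.
move=> cA cB; apply: (@cubf_sub [set x | x < a /\ forall t : bool, setT t -> (if t then A else B) x]).
  by move=> x [_ h]; split; [exact: (h true)|exact: (h false)].
apply: (@cubf_bigcap bool setT (fun t => if t then A else B)); last by move=> [].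
exact: small_bool.
Qed.

Lemma cubf_diag (A : O -> set O) : (forall x, x < a -> cubf (A x)) ->
  cubf [set z | z < a /\ forall x, x < z -> A x z].
Proof.
move=> cA.
have /boolp.choice[D DP] : forall p, exists D, p < a -> club a D /\ D `<=` A p.
  move=> p; have [/cA[D cD DA]|nW] := ltP p a; last by exists set0; ord.
  by exists D.
exists [set z | z < a /\ forall x, x < z -> D x z].
  by apply: club_diag => // p /DP[].
move=> z [za zD]; split=> // x xz; have [|_] := DP x; first by ord.
by apply; exact: zD.
Qed.

Lemma cubf_closed (F : O -> O) : (forall x, x < a -> F x < a) ->
  cubf [set z | z < a /\ forall x, x < z -> F x < z].
Proof.
move=> Fa; apply: (cubf_sub (A := [set z | z < a /\ forall x, x < z -> [set z | z < a /\ F x < z] z])).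
  by move=> z [za h]; split=> // x /h[].
by apply: cubf_diag => x xa; exact/cubf_club/club_gt/Fa.
Qed.

Lemma cubf_ex A x : cubf A -> x < a -> exists2 y, A y & x < y < a.
Proof.
move=> [D cD DA] xa; have [y Dy xy] := club_unb cD xa.
by exists y; [exact: DA|rewrite xy (club_lt cD Dy)].
Qed.

Lemma not_stat S : ~ stat S -> cubf (~` S).
Proof.
move=> /existsNP[D /not_implyP[cD no]]; exists D => // x Dx Sx.
by apply: no; exists x.
Qed.

Lemma stat_cubf S A : stat S -> cubf A -> exists x, [/\ S x, A x & x < a].
Proof.
move=> sS [D cD DA]; have [x Sx Dx] := sS D cD; exists x; split=> //; first exact: DA.
exact: (club_lt cD).
Qed.

Lemma statI S A : stat S -> cubf A -> stat (S `&` A).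
Proof.
move=> sS cA D cD; have [|x [Sx [Ax Dx] _]] := stat_cubf sS (A := A `&` D).
  by apply: cubfI => //; exact: cubf_club.
by exists x.
Qed.

Lemma stat_sub S S' : S `<=` S' -> stat S -> stat S'.
Proof. by move=> SS sS D /sS[x /SS ? ?]; exists x. Qed.

Lemma stat_unb S x : stat S -> x < a -> exists2 y, S y & x < y < a.
Proof.
move=> sS xa; have [y Sy [ya xy]] := sS _ (club_gt xa); exists y => //.
by rewrite xy.
Qed.

Lemma stat_bigcup (T : Type) (W : set T) S (A : T -> set O) :
  small a W -> stat S -> (forall x, S x -> x < a -> exists2 p, W p & A p x) ->
  exists2 p, W p & stat (S `&` A p).
Proof.
move=> sW sS SA; apply: contrapT => no.
have [p Wp|x [Sx [_ h] xa]] := stat_cubf sS (@cubf_bigcap _ W (fun p => ~` (S `&` A p)) sW _).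
  by apply: not_stat => h; apply: no; exists p.
by have [p Wp Ap] := SA x Sx xa; case: (h p Wp).
Qed.

Lemma Fodor S (f : O -> O) : stat S -> (forall x, S x -> x < a -> f x < x) ->
  exists2 c, c < a & stat [set x | S x /\ f x = c].
Proof.
move=> sS fS; apply: contrapT => no.
have [x xa|x [Sx [_ h] xa]] :=
  stat_cubf sS (@cubf_diag (fun c => ~` [set x | S x /\ f x = c]) _).
  by apply: not_stat => h; apply: no; exists x.
by have := h (f x) (fS x Sx xa); case.
Qed.

End RegularUncountable.

Lemma unb_enum a X : cf a = a -> cofinal a X ->
  exists2 f : O -> O, forall x, x < a -> X (f x) & forall x y, x < y -> y < a -> f x < f y.
Proof.
move=> cfa cX; have [b _ oX] := otp_exists wfO cX.1.
have := cf_le wfO cX oX; rewrite cfa => ab; case: oX => f [fX fm].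
exists f => [x xa|x y xy ya].
  by rewrite -fX; exists x => //; rewrite /pre/=; ord.
by apply: fm => //; ord.
Qed.

Lemma seq_lim a b (f : O -> O) : small a (pre b) -> limit b ->
  (forall x, x < b -> f x < a) -> (forall x y, x < y -> y < b -> f x < f y) ->
  exists z, [/\ z < a, limit z, forall x, x < b -> f x < z &
    forall y, y < z -> exists2 x, x < b & y < f x].
Proof.
move=> ra lb fa fm.
have [|c ca cP] := ra f; first exact: fa.
pose Z := [set z | forall x, x < b -> f x <= z].
have Zz : Z (omin Z) by exact: (omin_in wfO cP).
have zc : omin Z <= c by exact: (omin_le wfO cP).
have cofz x : x < omin Z -> exists2 y, y < b & x < f y.
  move=> xz; apply: contrapT => no.
  suff /(omin_le wfO) : Z x by ord.
  by move=> n nb; apply: neg_le => xf; apply: no; exists n.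
have ltz n : n < b -> f n < omin Z.
  move=> nb; have [c' nc cb] := lb.2 _ nb.
  by have := fm _ _ nc cb; have := Zz _ cb; ord.
exists (omin Z); split => //; first by ord.
split=> [|y /cofz[x xb yx]]; last by exists (f x) => //; exact: ltz.
by have := ltz _ lb.1; have := le0x (f \bot); ord.
Qed.

End Clubs.

(** * Reduction to ideals over lambda *)

Section Ideals.
Variables (d : Order.disp_t) (O : bOrderType d).
Hypothesis wfO : well_ordered O.
Implicit Types (a b c x y z : O) (A B D S X : set O) (I : set (set O)).

(** Completeness is indexed by [W], as in [small], so that it passes to products and finite words
    without cardinal arithmetic. *)
Definition closed_union (T : Type) I (W : set T) : Prop :=
  forall A : T -> set O, (forall p, W p -> I (A p)) -> I (\bigcup_(p in W) A p).

Definition uniform_ideal (lambda : O) I : Prop :=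
  [/\ proper_ideal lambda I,
      forall (T : Type) (W : set T), ~ (pre lambda #<= W) -> closed_union I W &
      Jbd lambda `<=` I].

Definition weakly_normal (lambda : O) I : Prop :=
  forall A (f : O -> O), A `<=` pre lambda -> ~ I A -> (forall x, A x -> f x < x) ->
    exists2 c, c < lambda & ~ I [set x | A x /\ f x < c].

Section UniformIdeal.
Variables (lambda : O) (I : set (set O)).
Hypothesis gI : uniform_ideal lambda I.

Lemma uniform_sub A B : B `<=` A -> I A -> I B.
Proof. by case: gI => -[[_ _ + _] _] _ _; exact. Qed.

Lemma uniform_setU A B : I A -> I B -> I (A `|` B).
Proof. by case: gI => -[[_ _ _ +] _] _ _; exact. Qed.

Lemma uniform_pre : ~ I (pre lambda).
Proof. by case: gI => -[]. Qed.

Lemma uniform_bd A b : b < lambda -> (forall x, A x -> x <= b) -> I A.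
Proof.
move=> bl Ab; case: gI => _ _; apply; split; first by move=> x /Ab; rewrite /pre/=; ord.
by exists b.
Qed.

Lemma closed_union_pre b : cardinal lambda -> b < lambda -> closed_union I (pre b).
Proof. by move=> cl bl; case: gI => _ + _; apply; exact: cl. Qed.

Lemma closed_union_nat : ~ countable (pre lambda) -> closed_union I [set: nat].
Proof. by move=> ul; case: gI => _ + _; apply. Qed.

Lemma closed_union_prod (T U : Type) (W : set T) (V : set U) :
  closed_union I W -> closed_union I V -> closed_union I (W `*` V).
Proof.
move=> cW cV A AI; apply: (@uniform_sub (\bigcup_(p in W) \bigcup_(q in V) A (p, q))).
  by move=> x [[p q] [/= Wp Vq] Ax]; exists p => //; exists q.
by apply: cW => p Wp; apply: cV => q Vq; exact: AI.
Qed.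

Lemma closed_union_image (T U : Type) (W : set T) (g : T -> U) :
  closed_union I W -> closed_union I (g @` W).
Proof.
move=> cW A AI; apply: (@uniform_sub (\bigcup_(p in W) A (g p))).
  by move=> x [_ [p Wp <-] Ax]; exists p.
by apply: cW => p Wp; apply: AI; exists p.
Qed.

Lemma closed_union_bigcup (T U : Type) (W : set T) (V : T -> set U) :
  closed_union I W -> (forall p, W p -> closed_union I (V p)) ->
  closed_union I (\bigcup_(p in W) V p).
Proof.
move=> cW cV A AI; apply: (@uniform_sub (\bigcup_(p in W) \bigcup_(q in V p) A q)).
  by move=> x [q [p Wp Vq] Ax]; exists p => //; exists q.
by apply: cW => p Wp; apply: cV => // q Vq; apply: AI; exists p.
Qed.

Lemma closed_union_sub (T : Type) (W V : set T) : W `<=` V ->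
  closed_union I V -> closed_union I W.
Proof.
move=> WV cV A AI.
apply: (@uniform_sub (\bigcup_(p in V) [set x | W p /\ A p x])).
  by move=> x [p Wp Ax]; exists p => //; exact: WV.
apply: cV => p _; have [Wp|nW] := pselect (W p).
  by apply: uniform_sub (AI p Wp) => x [].
by case: gI => -[[_ I0 Is _] _] _ _; apply: Is I0 => x [].
Qed.

Lemma closed_union_words (T : choiceType) (W : set T) : ~ countable (pre lambda) ->
  closed_union I W -> closed_union I [set s : seq T | forall x : T, x \in s -> W x].
Proof.
move=> ul cW.
have cn n : closed_union I [set s : seq T | size s = n /\ forall x : T, x \in s -> W x].
  elim: n => [|n IH].
    move=> A AI; apply: (uniform_sub _ (AI [::] _)); last by split.
    by move=> x [[|y s] [] //].
  apply: (@closed_union_sub _ _ ((fun p => p.1 :: p.2) @`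
      (W `*` [set s : seq T | size s = n /\ forall x : T, x \in s -> W x]))) => //.
    move=> [|x s] [] //= [sz] h; exists (x, s) => //; split => /=.
      by apply: h; rewrite inE eqxx.
    by split=> // y ys; apply: h; rewrite inE ys orbT.
  exact/closed_union_image/closed_union_prod.
apply: (@closed_union_sub _ _ (\bigcup_(n in [set: nat])
   [set s : seq T | size s = n /\ forall x : T, x \in s -> W x])) => //.
  by move=> s Ws; exists (size s).
by apply: closed_union_bigcup => //; exact: closed_union_nat.
Qed.

Lemma positive_bigcup (T : Type) (W : set T) S (A : T -> set O) :
  closed_union I W -> ~ I S -> (forall x, S x -> exists2 p, W p & A p x) ->
  exists2 p, W p & ~ I (S `&` A p).
Proof.
move=> cW nS SA; apply: contrapT => no; apply: nS.
apply: (@uniform_sub (\bigcup_(p in W) (S `&` A p))).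
  by move=> x Sx; have [p Wp Ap] := SA x Sx; exists p.
by apply: cW => p Wp; apply: contrapT => nI; apply: no; exists p.
Qed.

Lemma positive_ex S N b : ~ I S -> I N -> b < lambda -> exists x, [/\ S x, ~ N x & b < x].
Proof.
move=> nS iN bl; apply: contrapT => no; apply: nS.
apply: (@uniform_sub (N `|` [set x | x <= b])); last first.
  by apply: uniform_setU => //; apply: (uniform_bd bl).
move=> x Sx; have [Nx|nNx] := pselect (N x); first by left.
by right; apply: neg_le => bx; apply: no; exists x.
Qed.

End UniformIdeal.
End Ideals.

Section Reduction.
Variables (d : Order.disp_t) (O : bOrderType d).
Hypothesis wfO : well_ordered O.
Variables (kappa lambda theta : O) (T : set O) (J : O -> set (set O)) (C : O -> set O).
Hypothesis hkappa : regular_uncountable kappa.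
Hypothesis hlambda : infinite_cardinal lambda.
Hypothesis hJ : forall delta, Ecf kappa lambda delta ->
  [/\ proper_ideal delta (J delta), complete lambda (J delta) &
      Jbd delta `<=` J delta].
Hypothesis hC : bounded_C_sequence (Ecf kappa lambda) lambda C.
Hypothesis hguess : forall D, club kappa D ->
  exists2 delta, Ecf kappa lambda delta &
    positive delta (J delta)
      [set beta | beta < delta /\
         (D `&` T) (omin (C delta `\` [set x | x <= beta]))].

(* So [otp (C delta `&` pre beta)] is the least [x] with [beta <= e x]. *)
Lemma enum_C delta : Ecf kappa lambda delta -> exists e : O -> O,
  [/\ e @` pre lambda = C delta, forall x y, x < y -> y < lambda -> e x < e y &
      forall beta, beta < delta -> otp (C delta `&` pre beta) < lambda /\
        forall x, x < lambda -> (x < otp (C delta `&` pre beta)) = (e x < beta)].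
Proof.
move=> Ed; have cC := hC.1 _ Ed; have bC := hC.2 _ Ed.
have cofC : cofinal delta (C delta).
  split=> [|b /(club_unb cC)[y Cy]]; first by case: cC.
  by exists y => //; exact: ltW.
have [b _ oC] := otp_exists wfO cofC.1.
have lb : lambda <= b by rewrite -Ed.2; exact: (cf_le wfO cofC oC).
have bE : b = lambda by rewrite (otpE wfO oC) in bC; ord.
subst b; case: oC => e [eC em]; exists e; split=> // beta bd.
have [y Cy by_] := club_unb cC bd.
have [i0 i0l ei0] : (e @` pre lambda) y by rewrite eC.
pose Q := [set i | i < lambda /\ beta <= e i].
have Qi0 : Q i0 by split=> //; rewrite ei0 ltW.
have [il bi] : Q (omin Q) by exact: (omin_in wfO Qi0).
have imin x : x < lambda -> beta <= e x -> omin Q <= x.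
  by move=> xl bx; apply: (omin_le wfO).
suff -> : otp (C delta `&` pre beta) = omin Q.
  split=> // x xl; apply/idP/idP => h.
    by apply: neg_lt => /imin-/(_ xl); ord.
  apply: neg_lt; rewrite le_eqVlt => /orP[/eqP ix|ix]; first by rewrite -ix in h; ord.
  by have := em _ _ ix xl; ord.
apply: (otpE wfO); exists e; split; last by move=> x y' xy yi; apply: em => //; ord.
apply/seteqP; split=> [_ [x xi <-]|x [Cx xb]].
  have xl : x < lambda by rewrite /pre/= in xi; ord.
  split; first by rewrite -eC; exists x.
  by apply: neg_lt => /imin-/(_ xl); rewrite /pre/= in xi; ord.
move: Cx; rewrite -eC => -[u ul eu]; exists u => //; apply: neg_lt.
rewrite /pre/= in ul xb; rewrite le_eqVlt => /orP[/eqP iu|iu].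
  by rewrite -iu in eu; ord.
by have := em _ _ iu ul; ord.
Qed.

(** Guessing the trivial club yields some [delta] of cofinality [lambda]. A cofinal subset of
    [lambda] of smaller type would be carried by the enumeration of [C delta] to a cofinal subset of
    [delta] of that type. *)
Lemma lambda_regular : regular lambda.
Proof.
have cpre : club kappa (pre kappa).
  apply: mk_club => // x xk; exists (osucc x).
    exact: (limit_osucc wfO (regular_limit hkappa)).
  exact: (osucc_gt wfO xk).
have [delta Ed _] := hguess cpre; split=> //.
have [e [eC em _]] := enum_C Ed.
have [A cA [f [fA fm]]] := cf_ex wfO lambda.
have cl := cf_le_id wfO lambda; apply: neg_neq => [h|]; last by ord.
have : cf delta <= cf lambda.
  apply: (@cf_le _ _ wfO _ ((e \o f) @` pre (cf lambda))); last first.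
    exists (e \o f); split=> // x y xy yc /=; apply: em; first exact: fm.
    by apply: cA.1; rewrite -fA; exists y.
  have eClt x : x < lambda -> C delta (e x) by move=> xl; rewrite -eC; exists x.
  split.
    move=> _ [x xc <-]; apply: (club_lt (hC.1 _ Ed)); apply: eClt; apply: cA.1.
    by rewrite -fA; exists x.
  move=> b /(club_unb (hC.1 _ Ed))[y]; rewrite -eC => -[x xl <-] bex.
  have [z Az xz] := cA.2 _ xl; exists (e z).
    by move: Az; rewrite -fA => -[u uc <-]; exists u.
  move: xz; rewrite le_eqVlt => /orP[/eqP <-|xz]; first exact: ltW.
  by have := em _ _ xz (cA.1 _ Az); ord.
by rewrite Ed.2; ord.
Qed.

Definition positions delta B : set (set O) :=
  [set A | A `<=` pre lambda /\
     J delta [set beta | B beta /\ A (otp (C delta `&` pre beta))]].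

Lemma uniform_positions delta B : Ecf kappa lambda delta ->
  positive delta (J delta) B -> uniform_ideal lambda (positions delta B).
Proof.
move=> Ed [Bd nB]; have [e [eC em pC]] := enum_C Ed.
have [[[Jsub J0 Js JU] nJ] cJ bJ] := hJ Ed; split.
- split; first split.
  + by move=> A [].
  + by split => //; apply: Js J0 => x [].
  + move=> A A' AA [Al JA]; split; first exact: subset_trans Al.
    by apply: Js JA => x [Bx /AA].
  + move=> A A' [Al JA] [Al' JA']; split; first by rewrite subUset.
    by apply: Js (JU _ _ JA JA') => x [Bx []]; [left|right].
  move=> [_ JB]; apply: nB; apply: Js JB => x Bx; split=> //.
  by have [] := pC x (Bd x Bx).
- move=> U W lW A AI; split; first by move=> x [p /AI[Al _] /Al].
  pose g p := [set beta | B beta /\ A p (otp (C delta `&` pre beta))].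
  apply: Js (cJ (g @` W) _ _).
  + by move=> x [Bx [p Wp Ap]]; exists (g p) => //; exists p.
  + by move=> _ [p Wp <-]; have [] := AI p Wp.
  + by move=> h; apply: lW; apply: card_le_trans h _; exact: card_image_le.
- move=> A [Al [b bl Ab]]; split=> //; apply: bJ; split; first by move=> x [/Bd].
  (* A position at most [b] comes from some [beta] at most [e b]. *)
  exists (e b).
    by apply: (club_lt (hC.1 _ Ed)); rewrite -eC; exists b.
  move=> x [/Bd xd Ax]; have [_ /(_ b bl) h] := pC x xd.
  by apply: neg_le; rewrite -h; have := Ab _ Ax; ord.
Qed.

(** With [i beta] the position of [beta], the function sending [beta] to [e (f (i beta))] is
    regressive because [f (i beta) < i beta] means that its value is below [beta]. A bound [c] for
    it pulls back to the bound [i c] for [f]. *)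
Lemma weakly_normal_positions delta B : Ecf kappa lambda delta ->
  positive delta (J delta) B -> normal delta (J delta) ->
  weakly_normal lambda (positions delta B).
Proof.
move=> Ed [Bd nB] nJ A f Al nA fA; have [e [eC em pC]] := enum_C Ed.
have [[[Jsub J0 Js JU] _] cJ bJ] := hJ Ed.
pose i beta := otp (C delta `&` pre beta).
have [| |c cd [_ nc]] := nJ [set beta | B beta /\ A (i beta)] (fun beta => e (f (i beta))).
- by split=> [x [/Bd]//|JA]; apply: nA.
- move=> x [/Bd xd Ai]; have [ilt /(_ (f (i x))) h] := pC x xd.
  by rewrite -h ?fA//; have := fA _ Ai; rewrite -/(i x) in ilt; ord.
have [il ic] := pC c cd; exists (i c) => // -[_ Jc]; apply: nc.
apply: Js Jc => x [[Bx Ai] lt]; split=> //; split=> //=.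
by rewrite ic//; have := fA _ Ai; have := Al _ Ai; rewrite /pre/=; ord.
Qed.

(** Weak normality is offered conditionally, so that the same reduction serves all four cases. *)
Lemma reduction (P : Type) (W : set P) (c : P -> O -> O) :
  small kappa W ->
  (forall p i, W p -> i < lambda -> c p i < theta) ->
  (forall I, uniform_ideal lambda I ->
     ((forall delta, Ecf kappa lambda delta -> normal delta (J delta)) ->
       weakly_normal lambda I) ->
     exists2 p, W p &
       forall tau, tau < theta -> ~ I [set i | i < lambda /\ c p i = tau]) ->
  exists h : O -> O, (forall i, i < lambda -> h i < theta) /\
    forall D, club kappa D ->
      exists2 delta, Ecf kappa lambda delta &
        forall tau, tau < theta ->
          positive delta (J delta)
            [set beta | [/\ beta < delta,
               h (otp (C delta `&` pre beta)) = tau &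
               (D `&` T) (omin (C delta `\` [set x | x <= beta]))]].
Proof.
move=> sW ctheta cP; apply: contrapT => no.
have /boolp.choice[D DP] : forall p, exists D, W p -> club kappa D /\
    forall delta, Ecf kappa lambda delta -> exists tau, tau < theta /\
     ~ positive delta (J delta) [set beta | [/\ beta < delta,
               c p (otp (C delta `&` pre beta)) = tau &
               (D `&` T) (omin (C delta `\` [set x | x <= beta]))]].
  move=> p; have [Wp|] := pselect (W p); last by exists set0.
  apply: contrapT => noD; apply: no; exists (c p); split=> [i|D cD]; first exact: ctheta.
  apply: contrapT => nod; apply: noD; exists D => _; split=> // delta Ed.
  apply: contrapT => notau; apply: nod; exists delta => // tau taut.
  by apply: contrapT => np; apply: notau; exists tau.
have cD : club kappa (pre kappa `&` \bigcap_(p in W) D p).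
  by apply: (club_small_bigcap wfO hkappa) => // p /DP[].
(* This [delta] guesses all the clubs [D p] at once, so it refutes the failure of whichever [p]
   suits its ideal. *)
have [delta Ed pB] := hguess cD; move: pB; set B := [set beta | _] => pB.
have [|p Wp pP] := cP _ (uniform_positions Ed pB).
  by move=> /(_ delta Ed); exact: weakly_normal_positions.
have [_ /(_ delta Ed)[tau [taut np]]] := DP p Wp.
apply: (pP tau taut); split; first by move=> x [].
have [[[Jsub J0 Js JU] _] cJ bJ] := hJ Ed.
apply: contrapT => nJ; apply: np; split; first by move=> x [].
move=> JS; apply: nJ; apply: Js JS => x [[xd [[_ Dx] Tx]] [_ cx]]; split => //.
by split=> //; exact: Dx.
Qed.

End Reduction.

(** * Successor cardinals and pairing *)

Section SuccessorCase.
Variables (d : Order.disp_t) (O : bOrderType d).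
Hypothesis wfO : well_ordered O.
Implicit Types (a b c x y z : O).

Lemma cardinal_rep a : exists c, [/\ c <= a, cardinal c & pre a #<= pre c].
Proof.
pose Q := [set z : O | pre a #<= pre z].
have Qa : Q a by exact: card_lexx.
exists (omin Q); split; [exact: (omin_le wfO)| |exact: (omin_in wfO Qa)].
move=> b bm h; suff : omin Q <= b by ord.
apply: (omin_le wfO); apply: card_le_trans h; exact: (omin_in wfO Qa).
Qed.

(* The tuples [tau] of forbidden colours are enumerated in type [lambda], and
   the colours of [x] defeat those enumerated before [x]. *)
Lemma successor_coloring (lambda : O) : infinite_cardinal lambda ->
  lt_sequences lambda #= pre lambda -> successor_cardinal lambda ->
  exists2 mu, mu < lambda & exists c : O -> O -> O,
    (forall i x, c i x < lambda) /\
    forall I, uniform_ideal lambda I -> exists2 i, i < mu &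
      forall tau, tau < lambda -> ~ I [set x | x < lambda /\ c i x = tau].
Proof.
move=> il; rewrite card_eq_le => /andP[/(card_leS (\bot, fun=> \bot))[X XP] _].
move=> [cl [mu [cmu mul lmu]]].
have lim := infinite_cardinal_limit il.
exists mu => //.
have /boolp.choice[e eP] : forall x, exists e : O -> O, x < lambda ->
    forall y, y < x -> exists2 i, i < mu & e i = y.
  move=> x; have [xl|] := ltP x lambda; last by exists id; ord.
  have [c [cx cc xc]] := cardinal_rep x.
  have [] := @card_leS _ _ \bot (pre x) (pre mu); last by move=> e; exists e.
  apply: card_le_trans xc _; apply: subset_card_le => y; rewrite /pre/= => yc.
  suff : c <= mu by ord.
  by apply: neg_le => /(lmu _ cc); ord.
(* As [i] runs over [pre mu], the values [e x i] cover [pre x]; the colour is the [i]-th entry of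
   the tuple with number [e x i]. *)
pose c i x := if (X (e x i)).2 i < lambda then (X (e x i)).2 i else \bot.
exists c; split; first by move=> i x; rewrite /c; case: ifPn => // _; case: lim.
move=> I gI; apply: contrapT => no.
have /boolp.choice[t tP] : forall i, exists t, i < mu ->
    t < lambda /\ I [set x | x < lambda /\ c i x = t].
  move=> i; have [imu|] := ltP i mu; last by exists \bot; ord.
  apply: contrapT => not_; apply: no; exists i => // tau taul It.
  by apply: not_; exists tau.
pose s := (mu, fun x => if x < mu then t x else \bot).
have [|al all Xal] := XP s.
  split=> //= x; first by move=> xm; rewrite xm; have [] := tP x xm.
  by rewrite leNgt => /negbTE ->.
(* Every [x] beyond the number [al] of the tuple [s] satisfies [c i x = t i] for some [i < mu], so
   [mu] many sets in [I] cover a tail of [lambda]. *)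
apply: (uniform_pre gI).
apply: (uniform_sub gI (A := [set x | x <= al] `|` \bigcup_(i in pre mu) [set x | x < lambda /\ c i x = t i])).
  move=> x xl; have [xal|alx] := leP x al; [by left|right].
  have [i imu ei] := eP x xl al alx; exists i => //; split=> //.
  by rewrite /c ei Xal /= imu; have [-> _] := tP i imu.
apply: (uniform_setU gI); first exact: (uniform_bd gI all).
by apply: (closed_union_pre gI) => // p /tP[].
Qed.

End SuccessorCase.

Section Pairing.
Variables (d : Order.disp_t) (O : bOrderType d).
Hypothesis wfO : well_ordered O.
Implicit Types (a b c x y z : O).

Definition pair_key (p : O * O) : O := Order.max p.1 p.2.

(** Gödel's well-ordering of pairs: comparing maxima first keeps the predecessors of a pair inside
    the square of a smaller ordinal. *)
Definition pair_lt (p q : O * O) : Prop :=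
  pair_key p < pair_key q \/ (pair_key p = pair_key q /\
    (p.1 < q.1 \/ (p.1 = q.1 /\ p.2 < q.2))).

Lemma pair_lt_wf : well_founded pair_lt.
Proof.
suff H : forall m x y, pair_key (x, y) = m -> Acc pair_lt (x, y).
  by move=> [x y]; exact: H.
elim/(ord_ind wfO) => m IHm; elim/(ord_ind wfO) => x IHx; elim/(ord_ind wfO) => y IHy km.
constructor => -[x' y'] [|[k [/= xx|/= [xx yy]]]].
- by rewrite km => h; exact: (IHm (pair_key (x', y')) h x' y' erefl).
- by apply: IHx => //; rewrite k.
- by rewrite xx in k *; apply: IHy => //; rewrite k.
Qed.

Lemma pair_lt_total p q : [\/ pair_lt p q, p = q | pair_lt q p].
Proof.
case: p q => [x y] [x' y'].
have [kk|kk|kk] := ltgtP (pair_key (x, y)) (pair_key (x', y')).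
- by apply: Or31; left.
- by apply: Or33; left.
have [xx|xx|xx] := ltgtP x x'.
- by apply: Or31; right; split=> //; left.
- by apply: Or33; right; split=> //; left.
have [yy|yy|yy] := ltgtP y y'.
- by apply: Or31; right; split=> //; right.
- by apply: Or33; right; split=> //; right.
- by apply: Or32; rewrite xx yy.
Qed.

(** [F] assigns to each pair the least value not yet used. If it ran out of values below [a], the
    square of some [m < a] would cover [pre a], which the induction hypothesis for the cardinality
    of [m] forbids. *)
Lemma infinite_cardinal_prod a : infinite_cardinal a -> pre a `*` pre a #<= pre a.
Proof.
elim/(ord_ind wfO): a => a IH ia; have lim := infinite_cardinal_limit ia.
have [|F FE] := @wf_rec _ _ \bot _
  (fun p (F : O * O -> O) => omin [set z | forall q, pair_lt q p -> F q <> z]) pair_lt_wf.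
  by move=> p f g fg; congr omin; apply/seteqP; split => z h q qp /=;
    [rewrite -fg //|rewrite fg //]; exact: h.
have Fx p : pre a p.1 -> pre a p.2 ->
    exists2 x, x < a & [set z | forall q, pair_lt q p -> F q <> z] x.
  move=> p1 p2; apply: contrapT => nox.
  pose m := osucc (pair_key p).
  have ka : pair_key p < a by rewrite /pair_key gt_max; apply/andP.
  have ma : m < a by exact: (limit_osucc wfO).
  have am : pre a #<= pre m `*` pre m.
    apply: (@card_le_surj _ _ _ _ F) => x xa; apply: contrapT => no.
    apply: nox; exists x => // q qp Fq; apply: no; exists q => //.
    have km : pair_key p < m by exact: (osucc_gt wfO ka).
    have kq : pair_key q <= pair_key p by case: qp => [/ltW//|[-> _]].
    have : pair_key q < m by ord.
    by rewrite /pair_key gt_max => /andP[].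
  have fin_no : ~ finite_set (pre m).
    move=> fm; apply: ia.2; apply: card_le_finite am _; exact: finite_setX.
  have [c [cm cc mc]] := cardinal_rep wfO m.
  have ic : infinite_cardinal c.
    by split => // fc; apply: fin_no; exact: card_le_finite mc fc.
  have {}IH := IH c (le_lt_trans cm ma) ic.
  apply: (ia.1 c); first by ord.
  apply: card_le_trans am (card_le_trans _ IH).
  have [f [fc fi]] := card_leI \bot mc.
  apply: (@card_le_inj _ _ _ _ (fun p => (f p.1, f p.2))).
    by move=> q [q1 q2]; split; exact: fc.
  by move=> [x y] [x' y'] [/= x1 x2] [y1 y2] [/fi-> // /fi->].
apply: (@card_le_inj _ _ _ _ F).
  move=> p [p1 p2]; have [x xa xP] := Fx p p1 p2; rewrite /pre/= FE.
  by have := omin_le wfO xP; ord.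
have Flt p q : (pre a `*` pre a) p -> pair_lt q p -> F q <> F p.
  move=> [p1 p2] qp; have [x xa xP] := Fx p p1 p2.
  by rewrite [F p]FE; exact: (omin_in wfO xP).
move=> p q ap aq Fpq; have [pq|//|qp] := pair_lt_total p q.
  by have := Flt _ _ aq pq.
by have := Flt _ _ ap qp; rewrite Fpq.
Qed.

Lemma pairing a : infinite_cardinal a -> exists g : O -> O -> O,
  (forall x y, x < a -> y < a -> g x y < a) /\
  (forall x y x' y', x < a -> y < a -> x' < a -> y' < a ->
     g x y = g x' y' -> x = x' /\ y = y').
Proof.
move=> ia; have [f [fa fi]] := card_leI \bot (infinite_cardinal_prod ia).
exists (fun x y => f (x, y)); split=> [x y xa ya|x y x' y' xa ya xa' ya' h].
  exact: (fa (x, y)).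
by have [-> ->] := fi (x, y) (x', y') (conj xa ya) (conj xa' ya') h.
Qed.

End Pairing.

(** * Diamonds *)

Section Diamonds.
Variables (d : Order.disp_t) (O : bOrderType d).
Hypothesis wfO : well_ordered O.
Implicit Types (a b c x y z : O) (A B D X E : set O).

Lemma limit_infinite a : limit a -> infinite_set (pre a).
Proof.
move=> la; apply/infiniteP.
pose f n := iter n (@osucc _ O) \bot.
have fa n : f n < a by elim: n => [|n IH]; [case: la|exact: (limit_osucc wfO)].
have fS n : f n < f n.+1 by exact: (osucc_gt wfO (fa n)).
have fm n m : (n < m)%N -> f n < f m.
  by elim: m => // m IH; rewrite ltnS leq_eqVlt => /orP[/eqP ->//|/IH]; have := fS m; ord.
apply: (@card_le_inj _ _ _ _ f) => [n _|n m _ _ fnm]; first exact: fa.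
by case: (ltngtP n m) => // /fm; rewrite fnm ltxx.
Qed.

(** If [cf a = a] but [a] is no cardinal, enumerate [pre a] along some [b < a]. The records of this
    enumeration, the values exceeding all earlier ones, form a cofinal set of type at most [b]. *)
Lemma limit_cf_lt a : limit a -> ~ regular a -> cf a < a.
Proof.
move=> la nra; apply: neg_lt => ac.
have {ac} cfa : cf a = a by have := cf_le_id wfO a; ord.
apply: nra; split=> //; split; last exact: limit_infinite.
move=> b ba /(card_leS \bot)[p0 p0P].
pose p i := if p0 i < a then p0 i else \bot.
have pa i : p i < a by rewrite /p; case: ifP => // _; case: la.
have pP x : x < a -> exists2 i, i < b & p i = x.
  by move=> xa; have [i ib pi] := p0P x xa; exists i => //; rewrite /p pi xa.
pose R := [set i | i < b /\ forall k, k < i -> p k < p i].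
have [b' b'b [f [fR fm]]] : exists2 b', b' <= b & is_otp R b'.
  by apply: (otp_exists wfO) => i [].
have Rf x : x < b' -> R (f x) by move=> xb; rewrite -fR; exists x.
suff : cf a <= b' by ord.
apply: (@cf_le _ _ wfO _ ((p \o f) @` pre b')); last first.
  exists (p \o f); split=> // x y xy yb /=.
  by have [_] := Rf y yb; apply; exact: fm.
split=> [_ [x _ <-]|x xa]; first exact: pa.
have [i0 i0b pi0] := pP x xa.
pose Q := [set i | i < b /\ x <= p i].
have Qi0 : Q i0 by split=> //; rewrite pi0.
have [ib xi] : Q (omin Q) := omin_in wfO Qi0.
have : R (omin Q).
  split=> // k ki; suff : ~ (x <= p k) by ord.
  move=> xk; suff : omin Q <= k by ord.
  by apply: (omin_le wfO); split=> //; ord.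
rewrite -fR => -[u ub fu]; exists (p (omin Q)) => //.
by exists u => //=; rewrite fu.
Qed.

Section Normal.
Variables (lambda : O) (I : set (set O)).
Hypothesis rl : regular_uncountable lambda.
Hypothesis gI : uniform_ideal lambda I.
Hypothesis nI : weakly_normal lambda I.

Lemma normal_diag_union (N : O -> set O) : (forall i, i < lambda -> I (N i)) ->
  I [set x | x < lambda /\ exists2 i, i < x & N i x].
Proof.
move=> NI; apply: contrapT => nA.
set A := [set x | _] in nA.
have /boolp.choice[r rP] : forall x, exists i, A x -> i < x /\ N i x.
  move=> x; have [[xl [i ix Ni]]|] := pselect (A x); last by exists \bot.
  by exists i.
have [| |c cl] := nI (f := r) _ nA; first by move=> x [].
  by move=> x /rP[].
apply; apply: (uniform_sub gI (A := \bigcup_(i in pre c) N i)).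
  by move=> x [/rP[_ Nx] rc]; exists (r x).
apply: (closed_union_pre gI) => //; first by case: rl => -[[]].
by move=> i ic; apply: NI; rewrite /pre/= in ic; ord.
Qed.

(** Off a club [D], sending [x] to a bound below [x] of the part of [D] below [x] is regressive. If
    its values are below [c] on a positive set, the next point of [D] above [c] bounds that set. *)
Lemma normal_nonstationary A : cubf lambda A -> I (pre lambda `\` A).
Proof.
move=> [D cD DA]; apply: contrapT => nS.
have l0 := regular_bot rl.
pose S := [set x | [/\ x < lambda, \bot < x & ~ D x]].
have nS' : ~ I S.
  move=> IS; apply: nS; apply: (uniform_sub gI (A := S `|` [set x | x <= \bot])).
    move=> x [xl nA]; have [x0|x0] := leP x \bot; [by right|left].
    by split=> // /DA.
  by apply: (uniform_setU gI) => //; apply: (uniform_bd gI l0).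
have /boolp.choice[f fP] : forall x, exists b, S x ->
    b < x /\ forall y, D y -> y < x -> y <= b.
  move=> x; have [[xl x0 nD]|] := pselect (S x); last by exists \bot.
  apply: contrapT => no; apply: nD; apply: (club_closed cD) => // b bx.
  apply: contrapT => no'; apply: no; exists b => _; split=> // y Dy yx.
  by apply: neg_le => by_; apply: no'; exists y => //; ord.
have [| |c cl] := nI (f := f) _ nS'; first by move=> x [].
  by move=> x /fP[].
have [y Dy cy] := club_unb cD cl.
apply; apply: (uniform_bd gI (club_lt cD Dy)) => x [/fP[_ h] fc].
by apply: neg_le => yx; have := h y Dy yx; ord.
Qed.

End Normal.

(** Diamonds guess sets while the omitted colours form a function, so the function is coded by its
    graph under a pairing [g]. An initial segment closed under the coding determines the function
    there, see [graphK]. *)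
Definition graph (g : O -> O -> O) (lambda : O) (t : O -> O) : set O :=
  [set z | exists2 i, i < lambda & z = g i (t i)].

Definition ungraph (g : O -> O -> O) (lambda : O) (Y : set O) (i : O) : O :=
  xget \bot [set v | v < lambda /\ Y (g i v)].

Lemma ungraph_lt g lambda Y i : \bot < lambda -> ungraph g lambda Y i < lambda.
Proof. by rewrite /ungraph; case: xgetP => // x -> []. Qed.

Lemma graphK g lambda t de :
  (forall x y x' y', x < lambda -> y < lambda -> x' < lambda -> y' < lambda ->
     g x y = g x' y' -> x = x' /\ y = y') ->
  (forall i, i < lambda -> t i < lambda) -> de < lambda ->
  (forall i, i < de -> g i (t i) < de) ->
  forall i, i < de -> ungraph g lambda (graph g lambda t `&` pre de) i = t i.
Proof.
move=> gi tl dl cd i ide; have il : i < lambda by ord.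
apply: xget_unique => /=.
  by split; [exact: tl|split; [exists i|exact: cd]].
move=> v [vl [[j jl h] _]].
by have [ij vj] := gi _ _ _ _ il vl jl (tl j jl) h; rewrite vj ij.
Qed.

(** The colour [c i x] is the value at [i] of the function coded by the [i]-th guess at [x]. If each
    [c i] omitted [t i] modulo [I], then at club many [x] the graph of [t] would be guess number [i]
    for some [i < x], whence [c i x = t i]. A diagonal union of sets in [I] would cover a club. *)
Lemma diamond_star_coloring lambda : diamond_star lambda ->
  exists c : O -> O -> O, (forall i x, c i x < lambda) /\
    forall I, uniform_ideal lambda I -> weakly_normal lambda I ->
      exists2 i, i < lambda &
      forall tau, tau < lambda -> ~ I [set x | x < lambda /\ c i x = tau].
Proof.
move=> [rl [A [AP guess]]]; have l0 := regular_bot rl.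
have [g [gl gi]] := pairing wfO rl.1.1.
have /boolp.choice[s sP] : forall a, exists s : O -> set O, a < lambda ->
    forall Y, A a Y -> exists2 i, i < a & s i = Y.
  move=> a; have [al|] := ltP a lambda; last by exists (fun=> set0); ord.
  have [_ /(card_leS set0)[s sP]] := AP a al.
  by exists s => _.
exists (fun i x => ungraph g lambda (s x i) i); split=> [i x|I gI nI].
  exact: ungraph_lt.
apply: contrapT => no.
have /boolp.choice[t tP] : forall i, exists t, i < lambda ->
    t < lambda /\ I [set x | x < lambda /\ ungraph g lambda (s x i) i = t].
  move=> i; have [il|] := ltP i lambda; last by exists \bot; ord.
  apply: contrapT => not_; apply: no; exists i => // tau taul It.
  by apply: not_; exists tau.
have [|D cD DA] := guess (graph g lambda t).
  by move=> _ [i il ->]; apply: gl => //; have [] := tP i il.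
have cl := @cubf_closed _ _ wfO _ rl (fun i => g i (t i)).
have {}cl := cl (fun i il => gl _ _ il (tP i il).1).
have I1 := normal_nonstationary rl gI nI (cubfI wfO rl (cubf_club cD) cl).
have I2 := normal_diag_union rl gI nI (fun i il => (tP i il).2).
apply: (uniform_pre gI); apply: (uniform_sub gI _ (uniform_setU gI I1 I2)).
move=> x xl; have [[Dx [_ clx]]|nx] := pselect ((D `&` [set z | z < lambda /\ forall x, x < z -> g x (t x) < z]) x); last by left.
right; split=> //; have [i ix si] := sP x xl _ (DA x Dx).
exists i => //; split=> //; rewrite si; apply: graphK => // j jl.
by have [] := tP j jl.
Qed.

Lemma club_bounded_below lambda D b : club lambda D -> \bot < b -> b < lambda -> ~ D b ->
  exists2 c, c < b & forall y, D y -> y < b -> y <= c.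
Proof.
move=> cD b0 bl nD; apply: contrapT => no; apply: nD.
apply: (club_closed cD) => // c cb.
apply: contrapT => no'; apply: no; exists c => // y Dy yb.
by apply: neg_le => cy; apply: no'; exists y => //; ord.
Qed.

(* Every [de] in the club can be reached from any [b > de] by finitely many
   steps [b -> h b i] with labels [i < de]: a singular [b] has few labels, all of
   which point above its cofinality. *)
Lemma singular_steps lambda : regular_uncountable lambda -> ~ Mahlo lambda ->
  exists2 E : set O, cubf lambda E & exists h : O -> O -> O,
    (forall b i, \bot < b -> h b i < b) /\
    forall b de, b < lambda -> E de -> de < b ->
      exists2 i, i < de & de <= h b i.
Proof.
move=> rl nM.
have [D cD Dreg] : exists2 D, club lambda D & forall x, D x -> ~ regular x.
  apply: contrapT => no; apply: nM; split => //; split; first by move=> x [].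
  move=> D cD; apply: contrapT => no'; apply: no; exists D => // x Dx rx.
  by apply: no'; exists x; split=> //; split=> //; exact: (club_lt cD).
exists (D `&` [set z | z < lambda /\ limit z]).
  by apply: (cubfI wfO rl); apply: cubf_club => //; exact: club_limit.
suff /boolp.choice[h hP] : forall b, exists hb : O -> O, (forall i, \bot < b -> hb i < b) /\
    (b < lambda -> forall de, (D `&` [set z | z < lambda /\ limit z]) de -> de < b ->
      exists2 i, i < de & de <= hb i).
  exists h; split=> [b i|b de bl]; first by have [+ _] := hP b; exact.
  by have [_ +] := hP b; exact.
move=> b.
have [/andP[b0 bl]|nb] := pselect (\bot < b < lambda); last first.
  exists (fun=> \bot); split=> // bl de [_ [_ [de0 _]]] deb; case: nb.
  by have := le0x de; ord.
suff [[c cb cP]|[lb Db]] : (exists2 c, c < b & forall y, D y -> y < b -> y <= c) \/ (limit b /\ D b).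
- exists (fun=> c); split=> // _ de [Dde [_ [de0 _]]] deb.
  by exists \bot => //; exact: cP.
- have cb := limit_cf_lt lb (Dreg b Db).
  have [A cA [f [fA fm]]] := cf_ex wfO b.
  (* If [cf b <= de], some label below [cf b] names a member of the cofinal sequence at or above
     [de]. If [de < cf b], the label [\bot] suffices, as no step goes below [cf b]. *)
  exists (fun i => Order.max (cf b) (if i < cf b then f i else \bot)); split.
    move=> i _; rewrite gt_max cb; case: ifP => // ic; apply: cA.1.
    by rewrite -fA; exists i.
  move=> _ de [Dde [_ [de0 _]]] deb; have [cde|dec] := leP (cf b) de; last first.
    by exists \bot => //; rewrite le_max ltW.
  have [y Ay dey] := cA.2 _ deb; move: Ay; rewrite -fA => -[i ic fi].
  by exists i; [rewrite /pre/= in ic; ord|rewrite le_max ic fi dey orbT].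
have [Db|nDb] := pselect (D b); last by left; exact: (club_bounded_below cD).
have [lb|nlb] := pselect (limit b); [by right|left].
apply: contrapT => no; apply: nlb; split=> // c cb; apply: contrapT => no'.
by apply: no; exists c => // y _ yb; apply: neg_le => cy; apply: no'; exists y.
Qed.

(** Colouring number [p] decodes [p] to a word of labels, follows it from [x], and evaluates the
    guess at the endpoint at [p]. If [t] lists omitted colours, take [de] in [E], closed under the
    codings, where the graph of [t] is guessed. By completeness a single word [s] over [pre de]
    leads to [de] positively often; as [code s < de], the guess gives the colour [t (code s)]
    there. *)
Lemma diamond_coloring lambda : diamond lambda -> ~ Mahlo lambda ->
  exists c : O -> O -> O, (forall i x, c i x < lambda) /\
    forall I, uniform_ideal lambda I -> exists2 i, i < lambda &
      forall tau, tau < lambda -> ~ I [set x | x < lambda /\ c i x = tau].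
Proof.
move=> [rl [A [AP guess]]] nM; have l0 := regular_bot rl.
have [E cE [h [hb hE]]] := singular_steps rl nM.
have ll := regular_limit rl.
have [g [gl gi]] := pairing wfO rl.1.1.
pose psi := fix psi (s : seq O) b := if s is i :: s' then psi s' (h b i) else b.
have psiP b de : b < lambda -> E de -> \bot < de -> de <= b ->
    exists2 s : seq O, (forall i, i \in s -> i < de) & psi s b = de.
  move=> bl Ede de0; elim/(ord_ind wfO): b bl => b IH bl.
  rewrite le_eqVlt => /orP[/eqP <-|deb]; first by exists [::].
  have [i ide deh] := hE b de bl Ede deb.
  have hlt : h b i < b by apply: hb; ord.
  have [|s sde ps] := IH _ hlt _ deh; first by ord.
  by exists (i :: s) => // j; rewrite inE => /orP[/eqP ->//|/sde].
(* The successor separates nonempty words from the empty one, coded by [\bot]. *)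
pose code := fix code (s : seq O) := if s is i :: s' then osucc (g i (code s')) else \bot.
have codel (s : seq O) : (forall i, i \in s -> i < lambda) -> code s < lambda.
  elim: s => //= i s IH sl; apply: (limit_osucc wfO) => //; apply: gl.
    by apply: sl; rewrite inE eqxx.
  by apply: IH => j js; apply: sl; rewrite inE js orbT.
have code_inj (s s' : seq O) : (forall i, i \in s -> i < lambda) ->
    (forall i, i \in s' -> i < lambda) -> code s = code s' -> s = s'.
  elim: s s' => [|i s IH] [|i' s'] //= sl sl'.
  - have cl : g i' (code s') < lambda.
      apply: gl; first by apply: sl'; rewrite inE eqxx.
      by apply: codel => j js; apply: sl'; rewrite inE js orbT.
    have := osucc_gt wfO cl; move=> + h0; rewrite -h0.
    by move=> lt; exfalso; have := le0x (g i' (code s')); ord.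
  - have cl : g i (code s) < lambda.
      apply: gl; first by apply: sl; rewrite inE eqxx.
      by apply: codel => j js; apply: sl; rewrite inE js orbT.
    have := osucc_gt wfO cl; move=> + h0; rewrite h0.
    by move=> lt; exfalso; have := le0x (g i (code s)); ord.
  have il : i < lambda by apply: sl; rewrite inE eqxx.
  have il' : i' < lambda by apply: sl'; rewrite inE eqxx.
  have {}sl j : j \in s -> j < lambda by move=> js; apply: sl; rewrite inE js orbT.
  have {}sl' j : j \in s' -> j < lambda by move=> js; apply: sl'; rewrite inE js orbT.
  have gs := gl _ _ il (codel _ sl); have gs' := gl _ _ il' (codel _ sl').
  have o1 := osucc_gt wfO gs; have o2 := osucc_gt wfO gs'.
  move=> oeq; have [-> /(IH _ sl sl')->//] : i = i' /\ code s = code s'.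
  apply: gi => //; try exact: codel.
  apply: neg_neq => k; first by have := osucc_le wfO k; ord.
  by have := osucc_le wfO k; ord.
have /boolp.choice[dec decP] : forall p, exists s : seq O,
    forall s', (forall i, i \in s' -> i < lambda) -> code s' = p -> s' = s.
  move=> p; have [[s [sl cs]]|no] :=
    pselect (exists s : seq O, (forall i, i \in s -> i < lambda) /\ code s = p).
    by exists s => s' sl' cs'; apply: code_inj => //; rewrite cs'.
  by exists [::] => s' sl' cs'; case: no; exists s'.
exists (fun p x => ungraph g lambda (A (psi (dec p) x)) p); split=> [p x|I gI].
  exact: ungraph_lt.
apply: contrapT => no.
have /boolp.choice[t tP] : forall i, exists t, i < lambda ->
    t < lambda /\ I [set x | x < lambda /\ ungraph g lambda (A (psi (dec i) x)) i = t].
  move=> i; have [il|] := ltP i lambda; last by exists \bot; ord.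
  apply: contrapT => not_; apply: no; exists i => // tau taul It.
  by apply: not_; exists tau.
have [|_ guessX] := guess (graph g lambda t).
  by move=> _ [i il ->]; apply: gl => //; have [] := tP i il.
have cl1 := @cubf_closed _ _ wfO _ rl (fun i => g i (t i)).
have {}cl1 := cl1 (fun i il => gl _ _ il (tP i il).1).
have cl2 : cubf lambda [set z | z < lambda /\ forall i, i < z ->
    [set z | z < lambda /\ forall y, y < z -> g i y < z] z].
  apply: (cubf_diag wfO rl) => i il; apply: (cubf_closed wfO rl) => y yl.
  exact: gl.
have [K cK KP] := cubfI wfO rl cE (cubfI wfO rl (cubf_club (club_limit wfO rl)) (cubfI wfO rl cl1 cl2)).
have [de [[del Xde] /KP[Ede [[_ lde] [[_ clt] [_ clg]]]]]] := guessX K cK.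
have de0 := lde.1.
have codede (s : seq O) : (forall i, i \in s -> i < de) -> code s < de.
  elim: s => //= i s IH sl; apply: (limit_osucc wfO) => //.
  have ide : i < de by apply: sl; rewrite inE eqxx.
  have [_] := clg i ide; apply.
  by apply: IH => j js; apply: sl; rewrite inE js orbT.
have npos : ~ I [set x | x < lambda /\ de <= x].
  move=> IS; apply: (uniform_pre gI).
  apply: (uniform_sub gI _ (uniform_setU gI IS (uniform_bd gI (A := [set x | x <= de]) del _))) => //.
  by move=> x xl; have [dx|/ltW] := leP de x; [left|right].
have [|x [xl dx]|s sde nIs] := positive_bigcup gI (W := [set s : seq O | forall i : O, i \in s -> pre de i])
    (A := fun s => [set x | psi s x = de]) _ npos.
- apply: (closed_union_words gI rl.2); apply: (closed_union_pre gI) => //.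
  by case: rl => -[[]].
- by have [s sde ps] := psiP x de xl Ede de0 dx; exists s.
apply: nIs; have cs := codede s sde.
have csl : code s < lambda by ord.
apply: (uniform_sub gI _ (tP _ csl).2) => x [[xl dx] /= px]; split=> //.
have sl i : i \in s -> i < lambda by move=> /sde; rewrite /pre/=; ord.
rewrite -(decP (code s) s sl erefl) px -Xde; apply: graphK => // j jl.
by have [] := tP j jl.
Qed.

End Diamonds.

(** * Nontrivial C-sequences and walks *)

Section Nontrivial.
Variables (d : Order.disp_t) (O : bOrderType d).
Hypothesis wfO : well_ordered O.
Implicit Types (a b c x y z : O) (A B D X E : set O).

(** Unlike [club], this can hold at a successor [b], where [B] then contains the predecessor. *)
Definition closed_cofinal b B : Prop :=
  [/\ B `<=` pre b, forall x, x < b -> exists2 c, B c & x <= c &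
      forall z, \bot < z -> z < b -> (forall x, x < z -> exists2 y, B y & x < y < z) -> B z].

Definition nontrivial lambda A (C : O -> set O) : Prop :=
  (forall b, A b -> b < lambda -> closed_cofinal b (C b)) /\
  ~ exists2 D, club lambda D & forall g, g < lambda ->
      exists b, [/\ A b, g <= b, b < lambda & D `&` pre g `<=` C b].

(* Unless it contains [pre lambda], this ideal witnesses that [lambda] is
   greatly Mahlo. *)
Definition has_nontrivial lambda A : Prop :=
  A `<=` pre lambda /\ exists C, nontrivial lambda A C.

Section Fix_lambda.
Variable lambda : O.
Hypothesis rl : regular_uncountable lambda.

Lemma has_nontrivial_sub A B : B `<=` A -> has_nontrivial lambda A ->
  has_nontrivial lambda B.
Proof.
move=> BA [Al [C [cC nC]]]; split; first exact: subset_trans Al.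
exists C; split=> [b /BA|[D cD DP]]; first exact: cC.
by apply: nC; exists D => // g /DP[b [/BA ? ? ? ?]]; exists b.
Qed.

Lemma has_nontrivial_bd A c : c < lambda -> (forall x, A x -> x <= c) ->
  has_nontrivial lambda A.
Proof.
move=> cl Ac; split; first by move=> x /Ac; rewrite /pre/=; ord.
exists pre; split; first by move=> b Ab bl; split=> // x xb; exists x.
move=> [D cD /(_ (osucc c))[|b [/Ac bc gb _ _]]].
  exact: (limit_osucc wfO (regular_limit rl)).
by have := osucc_gt wfO cl; ord.
Qed.

Lemma has_nontrivial_bigcup (T : Type) (W : set T) (A : T -> set O) :
  small lambda W -> (forall p, W p -> has_nontrivial lambda (A p)) ->
  has_nontrivial lambda (\bigcup_(p in W) A p).
Proof.
move=> sW hA; split; first by move=> x [p /hA[Al _] /Al].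
have /boolp.choice[C CP] : forall p, exists C, W p -> nontrivial lambda (A p) C.
  move=> p; have [/hA[_ [C CP]]|] := pselect (W p); last by exists pre.
  by exists C.
have [[t0 _]|W0] := pselect (W !=set0); last first.
  exists pre; split; first by move=> b Ab bl; split=> // x xb; exists x.
  move=> [D cD /(_ _ (regular_bot rl))[b [[p Wp _] _ _ _]]].
  by apply: W0; exists p.
have /boolp.choice[q qP] : forall b, exists p, (\bigcup_(p in W) A p) b -> W p /\ A p b.
  move=> b; have [[p Wp Ab]|] := pselect ((\bigcup_(p in W) A p) b); last by exists t0.
  by exists p.
exists (fun b => C (q b) b); split.
  by move=> b /qP[Wq Aq] bl; have [+ _] := CP _ Wq; exact.
move=> [D cD DP].
have /boolp.choice[g gP] : forall p, exists g, W p -> g < lambda /\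
    forall b, A p b -> g <= b -> b < lambda -> ~ (D `&` pre g `<=` C p b).
  move=> p; have [Wp|] := pselect (W p); last by exists \bot.
  apply: contrapT => no; have [_] := CP p Wp; apply; exists D => // g gl.
  apply: contrapT => no'; apply: no; exists g => _; split=> // b Ab gb bl Dg.
  by apply: no'; exists b.
have [p /gP[]//|g0 g0l g0P] := sW g.
have [b [Ub g0b bl Db]] := DP g0 g0l.
have [Wq Aq] := qP b Ub; have [gl /(_ b Aq)] := gP _ Wq.
have := g0P _ Wq => gg; apply; [by ord|exact: bl|].
by move=> x [Dx xg]; apply: Db; split=> //; rewrite /pre/= in xg *; ord.
Qed.

Lemma has_nontrivialU A B : has_nontrivial lambda A -> has_nontrivial lambda B ->
  has_nontrivial lambda (A `|` B).
Proof.
move=> hA hB.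
apply: (has_nontrivial_sub (A := \bigcup_(t in [set: bool]) (if t then A else B))).
  by move=> x [Ax|Bx]; [exists true|exists false].
apply: has_nontrivial_bigcup; last by case.
exact: small_bool.
Qed.

(** The sequences of the fibres are glued and [C b] is cut off below [f b]. If [C b] contains a
    fixed point [de] of a threaded club, then [f b <= de], so only the fibres over [c <= de] matter,
    and their bounds [g c] have a common bound. *)
Lemma has_nontrivial_fibres A (f : O -> O) : A `<=` pre lambda -> regressive A f ->
  (forall c, has_nontrivial lambda [set b | A b /\ f b = c]) -> has_nontrivial lambda A.
Proof.
move=> Al fA hA; split=> //.
have /boolp.choice[C CP] : forall c, exists C, nontrivial lambda [set b | A b /\ f b = c] C.
  by move=> c; have [_] := hA c.
exists (fun b => C (f b) b `&` [set c | f b <= c]); split.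
  move=> b Ab bl; have [/(_ b (conj Ab erefl) bl)[Cb Cc Ccl] _] := CP (f b).
  split; first by move=> x [/Cb].
    move=> x xb; have [|c Cc' mc] := Cc (Order.max x (f b)).
      by rewrite gt_max xb fA.
    by move: mc; rewrite ge_max => /andP[xc fc]; exists c.
  move=> z z0 zb h; split.
    by apply: Ccl => // x /h[y [Cy _] xyz]; exists y.
  by have [y [_ /= fy] /andP[_ yz]] := h _ z0; rewrite /=; ord.
move=> [D cD DP].
have [de Dde _] := club_unb cD (regular_bot rl); have del := club_lt cD Dde.
have sl := limit_osucc wfO (regular_limit rl) del.
have ds := osucc_gt wfO del.
have /boolp.choice[g gP] : forall c, exists g, g < lambda /\
    forall b, A b -> f b = c -> g <= b -> b < lambda -> ~ (D `&` pre g `<=` C c b).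
  move=> c; apply: contrapT => no; have [_] := CP c; apply; exists D => // g gl.
  apply: contrapT => no'; apply: no; exists g; split=> // b Ab fb gb bl Dg.
  by apply: no'; exists b.
have [c _|g0 g0l g0P] := small_pre wfO rl.1 sl (f := g); first by have [] := gP c.
have [|b [Ab gb bl Db]] := DP (Order.max g0 (osucc de)); first by rewrite gt_max g0l.
move: gb; rewrite ge_max => /andP[g0b sb].
have [_ /= fde] : (C (f b) b `&` [set c | f b <= c]) de.
  by apply: Db; split=> //; rewrite /pre/= lt_max ds orbT.
have gg : g (f b) <= g0 by apply: g0P; rewrite /pre/=; ord.
have [gl /(_ b Ab erefl)] := gP (f b); apply => //; first by ord.
move=> x [Dx xg]; have [] // : (C (f b) b `&` [set c | f b <= c]) x.
by apply: Db; split=> //; rewrite /pre/= in xg *; rewrite lt_max; apply/orP; left; ord.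
Qed.

(** [C b] is the part of [b] above all points of [D] below [b], so it contains at most one point of
    [D]. A threaded club would meet [D] in two points of a single [C b]. *)
Lemma has_nontrivial_nonstationary A D : A `<=` pre lambda -> club lambda D ->
  (forall x, A x -> ~ D x) -> has_nontrivial lambda A.
Proof.
move=> Al cD AD; split=> //.
have /boolp.choice[g gP] : forall b, exists c, A b -> \bot < b ->
    c < b /\ forall y, D y -> y < b -> y <= c.
  move=> b; have [[Ab b0]|] := pselect (A b /\ \bot < b); last first.
    by move=> no; exists \bot => Ab b0; case: no.
  have [c cb cP] := club_bounded_below cD b0 (Al b Ab) (AD b Ab).
  by exists c.
exists (fun b => [set c | g b <= c < b]); split.
  move=> b Ab bl; split; first by move=> x /andP[].
    move=> x xb; have b0 : \bot < b by have := le0x x; ord.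
    have [gb _] := gP b Ab b0; exists (Order.max x (g b)); last by rewrite le_max lexx.
    by rewrite /= le_max lexx orbT gt_max xb gb.
  move=> z z0 zb /(_ _ z0)[y /andP[gy yb] /andP[_ yz]].
  by rewrite /= zb andbT; ord.
move=> [D' cD' DP].
have cDD := cubfI wfO rl (cubf_club cD) (cubf_club cD').
have [d1 [Dd1 D'd1] /andP[_ d1l]] := cubf_ex cDD (regular_bot rl).
have [d2 [Dd2 D'd2] /andP[d12 d2l]] := cubf_ex cDD d1l.
have sl := limit_osucc wfO (regular_limit rl) d2l; have ds := osucc_gt wfO d2l.
have [b [Ab sb bl Db]] := DP _ sl.
have /= /andP[gd1 _] : [set c | g b <= c < b] d1 by apply: Db; split=> //; rewrite /pre/=; ord.
have [|_ /(_ d2 Dd2)] := gP b Ab; first by have := le0x d2; ord.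
by have db : d2 < b by [ord]; move=> /(_ db); ord.
Qed.

(** By [has_nontrivial_fibres] the cofinality [rho] may be fixed. [C b] is the closure of a sequence
    of type [rho], too short to contain long initial segments of a club. *)
Lemma has_nontrivial_singular :
  has_nontrivial lambda [set b | [/\ b < lambda, limit b & ~ regular b]].
Proof.
set N := [set b | _].
apply: (@has_nontrivial_fibres _ (@cf _ O)); first by move=> x [].
  by move=> b [bl lb nb]; exact: limit_cf_lt.
move=> rho; split; first by move=> x [[]].
have /boolp.choice[f fP] : forall b, exists f : O -> O, N b -> cf b = rho ->
    [/\ forall i, i < rho -> f i < b, forall x, x < b -> exists2 i, i < rho & x <= f i &
        forall x y, x < y -> y < rho -> f x < f y].
  move=> b; have [A cA [f [fA fm]]] := cf_ex wfO b; exists f => Nb cb.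
  rewrite cb in fA fm; split=> //.
    by move=> i ir; apply: cA.1; rewrite -fA; exists i.
  by move=> x /cA.2[y]; rewrite -fA => -[i ir <-]; exists i.
pose C b := [set z | z < b /\ ((exists2 i, i < rho & z = f b i) \/
   (forall x, x < z -> exists2 i, i < rho & x < f b i < z))].
exists C; split.
  move=> b [Nb cb] bl; have [fb fc fm] := fP b Nb cb; split; first by move=> x [].
    move=> x /fc[i ir xf]; exists (f b i) => //.
    by split; [exact: fb|left; exists i].
  move=> z z0 zb h; split=> //; right=> x xz.
  have [y [yb [[i ir ->]|yl]] /andP[xy yz]] := h x xz; first by exists i => //; rewrite xy yz.
  by have [i ir /andP[xf fy]] := yl x xy; exists i => //; ord.
move=> [D cD DP].
have [e eD em] : exists2 e : O -> O, forall x, x < lambda -> D (e x) &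
    forall x y, x < y -> y < lambda -> e x < e y.
  apply: (unb_enum wfO rl.1.2); split; first by case: cD.
  by move=> x /(club_unb cD)[y Dy xy]; exists y => //; exact: ltW.
have [rhol|lrho] := ltP rho lambda; last first.
  have [b [[Nb cb] _ bl _]] := DP _ (regular_bot rl).
  by have := cf_le_id wfO b; ord.
have ll := limit_osucc wfO (regular_limit rl).
(* The gaps between the points [e x] and [e (osucc x)], for [x <= rho], use indices up to [rho + 1].
   Each gap contains a member of the sequence of type [rho], which gives an increasing map from
   [rho + 1] into [rho]. *)
pose k := osucc (osucc rho); have kl : k < lambda by apply: (ll); exact: ll.
have rs := osucc_gt wfO rhol; have ss := osucc_gt wfO (ll _ rhol).
have sel := ll _ (club_lt cD (eD k kl)); have es := osucc_gt wfO (club_lt cD (eD k kl)).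
have [b [[Nb cb] sb bl Db]] := DP _ sel.
have [fb fc fm] := fP b Nb cb.
have ex x : x < osucc rho -> exists2 i, i < rho & e x < f b i <= e (osucc x).
  move=> xr; have xl : x < lambda by have := ll _ rhol; ord.
  have sxk : osucc x < k.
    by have := osucc_le wfO xr; rewrite /k; ord.
  have xs := osucc_gt wfO xl; have exs : e x < e (osucc x) by apply: em => //; ord.
  have [|_ [[i ir ei]|h]] := Db (e (osucc x)).
  - split; first by apply: eD; ord.
    by rewrite /pre/=; have := em _ _ sxk kl; ord.
  - by exists i => //; rewrite -ei exs lexx.
  - by have [i ir /andP[h1 h2]] := h _ exs; exists i => //; rewrite h1 ltW.
pose Q x := [set i | i < rho /\ e x < f b i].
pose m x := omin (Q x).
have mP x : x < osucc rho -> [/\ m x < rho, e x < f b (m x) & f b (m x) <= e (osucc x)].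
  move=> xr; have [i ir /andP[h1 h2]] := ex x xr.
  have Qi : Q x i by [].
  have [mr em'] : Q x (m x) := omin_in wfO Qi.
  have : m x <= i := omin_le wfO Qi.
  rewrite le_eqVlt => /orP[/eqP mi|mi]; first by rewrite mi in mr em' *; split.
  by have := fm _ _ mi ir; split=> //; ord.
have mm x y : x < y -> y < osucc rho -> m x < m y.
  move=> xy yr; have xr : x < osucc rho by ord.
  have [mx1 mx2 mx3] := mP x xr; have [my1 my2 my3] := mP y yr.
  apply: (incr_refl fm) => //; suff : e (osucc x) <= e y by ord.
  have := osucc_le wfO xy; rewrite le_eqVlt => /orP[/eqP ->//|h].
  by apply: ltW; apply: em => //; have := ll _ rhol; ord.
have := incr_ge wfO mm rs; have [] := mP _ rs; ord.
Qed.

(** The main point is closure of the dual filter under [Mahlo_operation]. Where [X] is not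
    stationary, choose a club disjoint from [X]. A club threaded by these misses [X], so [X] is in
    the ideal; as its complement is too, so is [pre lambda]. *)
Lemma not_greatly_Mahlo_nontrivial : ~ greatly_Mahlo lambda ->
  exists C, nontrivial lambda (pre lambda) C.
Proof.
move=> nG; suff [//] : has_nontrivial lambda (pre lambda).
apply: contrapT => nK; apply: nG; split=> //.
exists (has_nontrivial lambda); split.
- split=> //; split=> [A []//| |A B|A B]; last exact: has_nontrivialU.
    by apply: (has_nontrivial_bd (regular_bot rl)).
  exact: has_nontrivial_sub.
- move=> F FK lF; apply: has_nontrivial_bigcup => //.
  by apply: (small_card wfO) => //; case: rl => -[].
- by move=> A [Al [b bl Ab]]; apply: (has_nontrivial_bd bl).
- move=> A f [Al nA] fA; apply: contrapT => no; apply: nA.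
  apply: (has_nontrivial_fibres Al fA) => c; apply: contrapT => nc.
  by apply: no; exists c; split=> // x [/Al].
move=> X [Xl NX]; split; first by move=> x [].
(* A countable cardinal cannot exceed the infinite ordinal [z0], so the countable regular [b] are
   bounded. *)
have [z0 [z0l lz0 _ _]] : exists z, [/\ z < lambda, limit z, \bot < z & True].
  have [z [zl lz]] := cubf_ex (cubf_club (club_limit wfO rl)) (regular_bot rl).
  by move=> /andP[z0 _]; exists z.
pose A2 := [set b | [/\ b < lambda, regular_uncountable b & ~ stationary b (X `&` pre b)]].
have K2 : has_nontrivial lambda A2.
  split; first by move=> x [].
  have /boolp.choice[C CP] : forall b, exists D, A2 b -> club b D /\ forall x, X x -> ~ D x.
    move=> b; have [[bl rb nb]|] := pselect (A2 b); last by exists set0.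
    apply: contrapT => no; apply: nb; split; first by move=> x [].
    move=> D cD; apply: contrapT => no'; apply: no; exists D => _; split=> // x Xx Dx.
    by apply: no'; exists x; split=> //; split=> //; exact: (club_lt cD).
  exists C; split.
    move=> b A2b bl; have [cC _] := CP b A2b; split; first by case: cC.
      by move=> x /(club_unb cC)[y Cy xy]; exists y => //; exact: ltW.
    by move=> z; exact: (club_closed cC).
  move=> [D cD DP]; apply: nK.
  apply: (has_nontrivial_sub (A := X `|` (pre lambda `\` X))).
    by move=> x xl; have [Xx|nX] := pselect (X x); [left|right].
  apply: has_nontrivialU => //; apply: (has_nontrivial_nonstationary Xl cD) => x Xx Dx.
  have xl := club_lt cD Dx; have xs := osucc_gt wfO xl.
  have [|b [A2b _ _ Db]] := DP (osucc x); first exact: (limit_osucc wfO (regular_limit rl)).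
  by have [_ /(_ x Xx)] := CP b A2b; apply; apply: Db.
apply: (has_nontrivial_sub (A := ((pre lambda `\` [set z | z < lambda /\ limit z]) `|` pre (osucc z0)) `|`
   ([set b | [/\ b < lambda, limit b & ~ regular b]] `|` A2))).
  move=> b [bl nM]; have [lb|nlb] := pselect (limit b); last by left; left; split=> // -[].
  have [rb|nrb] := pselect (regular b); last by right; left.
  have [cb|ncb] := pselect (countable (pre b)).
    left; right; apply: neg_lt => sb.
    have zb : z0 < b by have := osucc_gt wfO z0l; ord.
    apply: (rb.1.1 z0 zb); apply: card_le_trans cb _.
    by apply/infiniteP; exact: limit_infinite.
  by right; right; split=> // sX; apply: nM.
apply: has_nontrivialU; apply: has_nontrivialU => //; last exact: has_nontrivial_singular.
  apply: (has_nontrivial_nonstationary _ (club_limit wfO rl)); first by move=> x [].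
  by move=> x [].
by apply: (has_nontrivial_bd z0l) => x; exact: (le_osucc wfO z0l).
Qed.

(** * Minimal walks along a C-sequence *)

Definition step (C : O -> set O) j b : O :=
  if j < b then omin (C b `&` [set c | j <= c]) else b.
Definition walk (C : O -> set O) (n : nat) j b : O := iter n (step C j) b.

Lemma stepP (C : O -> set O) j b c : C b c -> j <= c -> j < b ->
  [/\ C b (step C j b), j <= step C j b & step C j b <= c].
Proof.
move=> Cc jc jb; rewrite /step jb.
have Qc : (C b `&` [set c | j <= c]) c by [].
by have [? ?] := omin_in wfO Qc; split=> //; exact: (omin_le wfO Qc).
Qed.

(** While [C b] is bounded below [de], by [x] say, all targets [j] between [x] and [de] give the
    same step, to the least member of [C b] at or above [de]. This descent ends at [de] or meets an
    [e > de] with [C e] unbounded in [de], uniformly for a tail of [j]. *)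
Lemma walk_to (C : O -> set O) de b :
  (forall b, b < lambda -> cofinal b (C b)) -> limit de -> b < lambda -> de <= b ->
  exists n g, g < de /\ ((forall j, g <= j -> j < de -> walk C n j b = de) \/
    exists e, [/\ de < e, e < lambda, forall j, g <= j -> j < de -> walk C n j b = e &
       forall x, x < de -> exists2 c, C e c & x < c < de]).
Proof.
move=> cC lde; elim/(ord_ind wfO): b => b IH bl.
rewrite le_eqVlt => /orP[/eqP <-|deb].
  by exists 0%N, \bot; split; [case: lde|left].
have [unb|bd] := pselect (forall x, x < de -> exists2 c, C b c & x < c < de).
  by exists 0%N, \bot; split; [case: lde|right; exists b].
have [Cb Cc] := cC b bl.
have [x [xde xP]] : exists x, x < de /\ forall c, C b c -> c < de -> c <= x.
  apply: contrapT => no; apply: bd => x xde; apply: contrapT => no'; apply: no.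
  exists x; split=> // c Cbc cde; apply: neg_le => xc; apply: no'; exists c => //.
  by rewrite xc.
have [c Cbc dec] := Cc de deb.
have sx : osucc x < de by exact: (limit_osucc wfO).
have xs := osucc_gt wfO xde.
have [Cs des sc] := stepP Cbc dec deb.
have stepE j : osucc x <= j -> j < de -> step C j b = step C de b.
  move=> xj jde; have jb : j < b by ord.
  have [Cs' js' s'c] := stepP Cs (le_trans (ltW jde) des) jb.
  have des' : de <= step C j b.
    by apply: neg_le => /(xP _ Cs'); ord.
  by have [_ _] := stepP Cs' des' deb; ord.
have sb : step C de b < b by exact: Cb.
have [|n [g [gde hn]]] := IH _ sb _ des; first by ord.
exists n.+1, (Order.max g (osucc x)); split; first by rewrite gt_max gde.
have wE j : Order.max g (osucc x) <= j -> j < de -> walk C n.+1 j b = walk C n j (step C de b).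
  by rewrite ge_max => /andP[gj xj] jde; rewrite /walk iterSr stepE.
case: hn => [h|[e [dee el eP eC]]]; [left|right].
  move=> j mj jde; rewrite wE//; apply: h => //.
  by move: mj; rewrite ge_max => /andP[].
exists e; split=> // j mj jde; rewrite wE//; apply: eP => //.
by move: mj; rewrite ge_max => /andP[].
Qed.

(** Otherwise, for each [j], fibres over ordinals from [eps j] on are in [I], for all [n]. Let [de]
    be closed under [eps]. Positively many [b] share [n] and [g] in [walk_to]; they cannot all hit
    [de], since [eps g < de], so positively many pass through an [e] with [C e] unbounded in [de].
    Off a set in [I], the next step towards [j] lands below [eps j], so [C e] contains all points of
    [E] between [g] and [de]. Pressing down on [g] yields a threaded club. *)
Lemma nontrivial_walks (C : O -> set O) I : nontrivial lambda (pre lambda) C ->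
  uniform_ideal lambda I -> exists n j, j < lambda /\
    forall x, x < lambda -> exists2 xi, x <= xi < lambda &
      ~ I [set b | b < lambda /\ walk C n j b = xi].
Proof.
move=> [cC nC] gI; apply: contrapT => no.
have {}cC b : b < lambda -> closed_cofinal b (C b) by move=> bl; exact: cC.
have cofC b : b < lambda -> cofinal b (C b) by move=> /cC[].
have /boolp.choice[eps0 eps0P] : forall p : nat * O, exists e, p.2 < lambda -> e < lambda /\
    forall xi, e <= xi -> xi < lambda -> I [set b | b < lambda /\ walk C p.1 p.2 b = xi].
  move=> [n j] /=; have [jl|] := ltP j lambda; last by exists \bot; ord.
  apply: contrapT => no'; apply: no; exists n, j; split=> // x xl.
  apply: contrapT => no2; apply: no'; exists x => _; split=> // xi xxi xil.
  by apply: contrapT => nI; apply: no2; exists xi => //; rewrite xxi.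
have /boolp.choice[eps epsP] : forall j, exists e, j < lambda -> e < lambda /\
    forall n xi, e <= xi -> xi < lambda -> I [set b | b < lambda /\ walk C n j b = xi].
  move=> j; have [jl|] := ltP j lambda; last by exists \bot; ord.
  have [|e el eP] := small_nat wfO rl (f := fun n => eps0 (n, j)).
    by move=> n _; have [] := eps0P (n, j) jl.
  exists e => _; split=> // n xi exi xil; have [_] := eps0P (n, j) jl; apply => //=.
  by have := eP n Logic.I; ord.
have cl : cardinal lambda by case: rl => -[[]].
pose E := [set z | z < lambda /\ limit z] `&` [set z | z < lambda /\ forall x, x < z -> eps x < z].
have cE : cubf lambda E.
  apply: (cubfI wfO rl); first exact/cubf_club/club_limit.
  by apply: (cubf_closed wfO rl) => x /epsP[].
have EP de : E de -> exists g, g < de /\ exists e, [/\ de < e, e < lambda &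
    forall z, E z -> g < z -> z < de -> C e z].
  move=> [[del lde] [_ clde]]; have de0 := lde.1.
  have npos : ~ I [set x | x < lambda /\ de <= x].
    move=> IS; apply: (uniform_pre gI).
    apply: (uniform_sub gI _ (uniform_setU gI IS (uniform_bd gI (A := [set x | x <= de]) del _))) => //.
    by move=> x xl; have [dx|/ltW] := leP de x; [left|right].
  pose Hit n g := [set b | forall j, g <= j -> j < de -> walk C n j b = de].
  pose Pass n g := [set b | exists e, [/\ de < e, e < lambda, forall j, g <= j -> j < de -> walk C n j b = e &
       forall x, x < de -> exists2 c, C e c & x < c < de]].
  have [|b [bl deb]|[n g] [_ /= gde] nI] := positive_bigcup gI (W := [set: nat] `*` pre de)
      (A := fun p => Hit p.1 p.2 `|` Pass p.1 p.2) _ npos.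
  - apply: (closed_union_prod gI); first exact: (closed_union_nat gI rl.2).
    exact: (closed_union_pre gI).
  - have [n [g [gde h]]] := walk_to cofC lde bl deb; exists (n, g) => //.
  have gl : g < lambda by rewrite /pre/= in gde; ord.
  have nPass : ~ I ([set x | x < lambda /\ de <= x] `&` Pass n g).
    move=> IP; apply: nI; apply: (uniform_sub gI _ (uniform_setU gI IP _)); last first.
      have [_ /(_ n de)] := epsP g gl; apply; last by ord.
      by apply: ltW; exact: clde.
    move=> b [[bl deb] [hb|pb]]; last by left.
    by right; split=> //; apply: hb.
  (* All targets [j] and all landing points below [de] are handled at once, being fewer than
     [lambda]. *)
  have In : I (\bigcup_(j in pre de) [set b | b < lambda /\ eps j <= walk C n.+1 j b < de]).
    apply: (closed_union_pre gI) => // j jde.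
    have jl : j < lambda by rewrite /pre/= in jde; ord.
    apply: (uniform_sub gI (A := \bigcup_(xi in pre de) [set b | [/\ eps j <= xi, xi < lambda, b < lambda & walk C n.+1 j b = xi]])).
      move=> b [bl /andP[h1 h2]]; exists (walk C n.+1 j b) => //; split=> //.
      by rewrite /pre/= in h2 *; ord.
    apply: (closed_union_pre gI) => // xi xide.
    have [[exi xil]|nn] := pselect (eps j <= xi /\ xi < lambda).
      have [_ /(_ n.+1 xi exi xil)] := epsP j jl.
      by apply: (uniform_sub gI) => b [].
    by apply: (uniform_bd gI (regular_bot rl)) => x [? ? _ _]; case: nn.
  have [b [[[bl deb] [e [dee el eP eC]]] nb _]] := positive_ex gI nPass In (regular_bot rl).
  exists g; split=> //; exists e; split=> // z [[zl lz] [_ clz]] gz zde.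
  have [_ _ ecl] := cC e el; apply: ecl; [by case: lz|by ord|] => x xz.
  have mz : Order.max x g < z by rewrite gt_max xz.
  pose j := osucc (Order.max x g).
  have jz : j < z by exact: (limit_osucc wfO).
  have := osucc_gt wfO mz; rewrite -/j gt_max => /andP[xj gj].
  have jde : j < de by ord.
  have [c Ce /andP[jc cde]] := eC j jde.
  have je : j < e by ord.
  have [Cs js sc] := stepP Ce (ltW jc) je.
  exists (step C j e) => //.
  have wE : walk C n.+1 j b = step C j e by rewrite /walk iterS -/(walk C n j b) eP// ltW.
  suff : step C j e < eps j by have := clz j jz; ord.
  apply: neg_lt => es; apply: nb; exists j => //; split=> //.
  by rewrite wE es; ord.
have /boolp.choice[g gP] : forall de, exists g, E de -> g < de /\ exists e,
    [/\ de < e, e < lambda & forall z, E z -> g < z -> z < de -> C e z].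
  move=> de; have [/EP[g gP]|] := pselect (E de); last by exists \bot.
  by exists g.
have [K cK KE] := cE.
have sK : stat lambda K.
  move=> D cD; have [x [Kx Dx] _] := cubf_ex (cubfI wfO rl (cubf_club cK) (cubf_club cD)) (regular_bot rl).
  by exists x.
have [|c cl' sc] := Fodor wfO rl sK (f := g); first by move=> x /KE/gP[].
have cKc := cubfI wfO rl (cubf_club cK) (cubf_club (club_gt wfO rl cl')).
have [D cD DK] := cKc.
apply: nC; exists D => // ga gal.
have [de [Kde gde] /andP[gade del]] := stat_unb wfO rl sc gal.
have [_ [e [dee el eP]]] := gP de (KE _ Kde).
exists e; split=> //; first by ord.
move=> z [/DK[Kz [_ cz]] zga]; apply: eP; first exact: KE.
  by rewrite gde.
by rewrite /pre/= in zga; ord.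
Qed.

End Fix_lambda.
End Nontrivial.

(** * Club guessing *)

Section ClubGuessing.
Variables (d : Order.disp_t) (O : bOrderType d).
Hypothesis wfO : well_ordered O.
Implicit Types (a b c x y z : O) (A B D X E : set O).

Definition last_in E x z : Prop :=
  [/\ E z, z <= x & forall w, E w -> w <= x -> w <= z].

Lemma last_in_ex lambda E x w : club lambda E -> x < lambda -> E w -> \bot < w -> w <= x ->
  exists z, last_in E x z.
Proof.
move=> cE xl Ew w0 wx.
pose Z := [set z | forall u, E u -> u <= x -> u <= z].
have Zx : Z x by move=> u.
have zx : omin Z <= x := omin_le wfO Zx.
have Zz : Z (omin Z) := omin_in wfO Zx.
exists (omin Z); split=> //; have [//|nE] := pselect (E (omin Z)).
apply: (club_closed cE); [by have := Zz w Ew wx; ord|by ord|] => y yz.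
apply: contrapT => no.
suff /(omin_le wfO) : Z y by rewrite -/Z; ord.
move=> u Eu ux; apply: neg_le => yu; have := Zz u Eu ux.
rewrite le_eqVlt => /orP[/eqP uz|uz]; first by rewrite uz in Eu.
by apply: no; exists u => //; rewrite yu.
Qed.

(* A decreasing sequence of clubs of length [chi], each defeating the previous
   one, is impossible: on a set [e y] that is small for [chi] all the values
   [last_in (K i) x] are eventually constant. *)
Lemma club_guessing (lambda chi : O) (Y : Type) (e : Y -> set O) (Rich : set O -> Y -> Prop) :
  regular_uncountable lambda -> chi < lambda -> limit chi ->
  (forall y : Y, small chi (e y)) ->
  (forall E E' (y : Y), E `<=` E' -> Rich E y -> Rich E' y) ->
  (forall E, club lambda E -> exists y : Y, Rich E y) ->
  exists2 E, club lambda E & forall D, club lambda D -> exists y : Y,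
    Rich (E `&` D) y /\ forall x z, e y x -> last_in E x z -> D z.
Proof.
move=> rl chil lchi sme Rmono Rex; apply: contrapT => no.
have /boolp.choice[F FP] : forall E, exists E', club lambda E -> [/\ club lambda E', E' `<=` E &
    forall y : Y, Rich E' y -> exists x z, [/\ e y x, last_in E x z & ~ E' z]].
  move=> E; have [cE|] := pselect (club lambda E); last by exists set0.
  have [D [cD DP]] : exists D, club lambda D /\ ~ exists y : Y,
      Rich (E `&` D) y /\ forall x z, e y x -> last_in E x z -> D z.
    apply: contrapT => no'; apply: no; exists E => // D cD.
    by apply: contrapT => no2; apply: no'; exists D.
  have [D' cD' D'ED] := cubfI wfO rl (cubf_club cE) (cubf_club cD).
  exists D' => _; split=> //; first by move=> x /D'ED[].
  move=> y Ry; apply: contrapT => no'; apply: DP; exists y; split.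
    exact: Rmono Ry.
  move=> x z ex lz; apply: contrapT => nD; apply: no'; exists x, z; split=> //.
  by move=> /D'ED[].
have [|K KE] := @wf_rec _ _ set0 _ (fun i (K : O -> set O) =>
    pre lambda `&` \bigcap_(k in pre i) F (K k)) wfO.
  move=> i f g fg; congr (_ `&` _); apply/seteqP; split=> x h k ki.
    by rewrite -fg//; exact: h.
  by rewrite fg//; exact: h.
have cK i : i <= chi -> club lambda (K i).
  elim/(ord_ind wfO): i => i IH ic; rewrite KE; apply: (club_small_bigcap wfO rl).
    by apply: (small_pre wfO rl.1); ord.
  move=> k ki; have [] // := FP (K k); apply: IH => //.
  by rewrite /pre/= in ki; ord.
have KF i k : k < i -> K i `<=` F (K k) by move=> ki x; rewrite KE => -[_]; exact.
have [y Ry] := Rex _ (cK chi (lexx _)).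
have /boolp.choice[p pP] : forall i, exists p : O * O, i < chi ->
    [/\ e y p.1, last_in (K i) p.1 p.2 & ~ F (K i) p.2].
  move=> i; have [ic|] := ltP i chi; last by exists (i, i); ord.
  have [_ _ /(_ y)[|x [z [ex lz nF]]]] := FP _ (cK i (ltW ic)).
    by apply: Rmono Ry; exact: KF.
  by exists (x, z).
(* A failure at stage [i] removes [(p i).2] from all later clubs, so failures at one and the same
   [x] have strictly descending last points. *)
have drop i k : i < k -> k < chi -> (p i).1 = (p k).1 -> (p k).2 < (p i).2.
  move=> ik kc pe; have [ei [Ki zi li] ni] := pP i (lt_trans ik kc).
  have [ek [Kk zk lk] nk] := pP k kc.
  have Fk : F (K i) (p k).2 by exact: KF Kk.
  have [_ FK _] := FP _ (cK i (ltW (lt_trans ik kc))).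
  have : (p k).2 <= (p i).2 by apply: li; [exact: FK|rewrite pe].
  by rewrite le_eqVlt => /orP[/eqP pp|//]; case: ni; rewrite -pp.
have /boolp.choice[b bP] : forall x, exists b, b < chi /\
    forall i, b <= i -> i < chi -> (p i).1 <> x.
  move=> x; apply: contrapT => no'.
  have often b : b < chi -> exists i, [/\ b <= i, i < chi & (p i).1 = x].
    move=> bc; apply: contrapT => no2; apply: no'; exists b; split=> // i bi ic px.
    by apply: no2; exists i.
  have [i0 [_ i0c i0x]] := often _ lchi.1.
  pose Q := [set z | exists i, [/\ i < chi, (p i).1 = x & z = (p i).2]].
  have Qi0 : Q (p i0).2 by exists i0.
  have [i [ic ix qi]] := omin_in wfO Qi0.
  have [k [ik kc kx]] := often _ (limit_osucc wfO lchi ic).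
  have si := osucc_gt wfO ic.
  have := drop i k (lt_le_trans si ik) kc; rewrite ix kx => /(_ erefl).
  have : omin Q <= (p k).2 by apply: (omin_le wfO); exists k.
  by rewrite qi; ord.
have [|be bec beP] := sme y b; first by move=> x _; have [] := bP x.
have [eb _ _] := pP be bec; have [_ /(_ be)] := bP (p be).1; apply => //.
exact: beP.
Qed.

(* [t] when [s t < x <= s (t + 1)]. *)
Definition rank_in (s : O -> O) x : O := omin [set t | x <= s (osucc t)].

Lemma rank_inE (s : O -> O) sigma x t : (forall x y, x < y -> y < sigma -> s x < s y) ->
  t < osucc t -> osucc t < sigma -> s t < x -> x <= s (osucc t) -> rank_in s x = t.
Proof.
move=> sm ts ss sx xs; have Qt : [set t | x <= s (osucc t)] t by [].
have le := omin_le wfO Qt; rewrite /rank_in in le *; apply: neg_neq => [lt|]; last by ord.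
have := omin_in wfO Qt; rewrite /= => h.
have := osucc_le wfO lt; rewrite le_eqVlt => /orP[/eqP eq|lt'].
  by rewrite eq in h; ord.
by have := sm _ _ lt' (lt_trans ts ss); ord.
Qed.

Lemma unbounded_lt lambda X : limit lambda -> cofinal lambda X ->
  forall x, x < lambda -> exists2 y, X y & x < y < lambda.
Proof.
move=> ll [Xl Xu] x xl; have [y Xy sy] := Xu _ (limit_osucc wfO ll xl).
by exists y => //; have := osucc_gt wfO xl; have := Xl y Xy; rewrite /pre/=; ord.
Qed.

(** The guessed club consists of common limit points of all [X n]. Each [s y (osucc t)] is then such
    a limit point, so every [X n] has a member between [s y t] and it, of rank [t]. Countably many
    [X n] are treated together for the sake of [projections_successor]. *)
Lemma guessing_ranks (lambda chi sigma : O) (Y : Type) (V : set Y) (e : Y -> set O) (Rich : set O -> Y -> Prop) :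
  regular_uncountable lambda -> chi < lambda -> limit chi ->
  (forall y : Y, small chi (e y)) ->
  (forall E E' (y : Y), E `<=` E' -> Rich E y -> Rich E' y) ->
  (forall E (y : Y), Rich E y -> V y) ->
  (forall E, club lambda E -> exists y : Y, Rich E y) ->
  (forall E D (y : Y), club lambda E -> Rich (E `&` D) y -> exists2 s : O -> O,
     (forall x y, x < y -> y < sigma -> s x < s y) &
     forall i, i < sigma -> exists2 x, e y x & last_in E x (s i)) ->
  exists s : Y -> O -> O, forall X : nat -> set O, (forall n, cofinal lambda (X n)) ->
    exists2 y : Y, V y & forall n t, t < osucc t -> osucc t < sigma ->
      exists2 x, X n x & rank_in (s y) x = t.
Proof.
move=> rl chil lchi sme Rmono RV Rex Rs.
have [E cE EP] := club_guessing rl chil lchi sme Rmono Rex.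
have /boolp.choice[s sP] : forall y : Y, exists s : O -> O,
    (exists D, Rich (E `&` D) y) ->
    (forall x y, x < y -> y < sigma -> s x < s y) /\
    forall i, i < sigma -> exists2 x, e y x & last_in E x (s i).
  move=> y; have [[D RD]|no] := pselect (exists D, Rich (E `&` D) y); last by exists id.
  by have [s sm sE] := Rs _ _ _ cE RD; exists s.
exists s => X Xu.
have ll := regular_limit rl.
have [|D DP] := cubf_bigcap wfO rl (small_nat wfO rl)
   (A := fun n => [set z | [/\ z < lambda, \bot < z & forall x, x < z -> exists2 y, X n y & x < y < z]]).
  by move=> n _; exact/cubf_club/(club_acc wfO rl)/unbounded_lt.
move=> DX; have [y [Ry yD]] := EP D DP.
have [|sm sE] := sP y; first by exists D.
exists y; first exact: RV Ry.
move=> n t ts ss; have [x ex lx] := sE _ ss.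
have [_ /(_ n Logic.I)[_ _ h]] := DX _ (yD _ _ ex lx).
have [w Xw /andP[sw ws]] := h (s y t) (sm _ _ ts ss).
by exists w => //; apply: (rank_inE sm) => //; exact: ltW.
Qed.

(* The case [theta^+ < lambda]: guess with cofinal sets of order type [theta]. *)
Lemma projections_large lambda theta chi0 : regular_uncountable lambda -> regular theta ->
  chi0 < lambda -> ~ (pre chi0 #<= pre theta) ->
  exists s : O -> O -> O, forall X, cofinal lambda X ->
    exists2 y, y < lambda & forall t, t < theta -> exists2 x, X x & rank_in (s y) x = t.
Proof.
move=> rl rth.
pose Q := [set z : O | ~ (pre z #<= pre theta)].
move=> chi0l nchi0; have Qchi0 : Q chi0 by [].
(* This is the cardinal successor of [theta]: the guessed sets are small for it, and it is still
   below [lambda]. *)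
pose chi := omin Q.
have nchi : ~ (pre chi #<= pre theta) by exact: (omin_in wfO Qchi0).
have chimin c : c < chi -> pre c #<= pre theta.
  by move=> cc; apply: contrapT => nc; have : chi <= c := omin_le wfO (nc : Q c); ord.
have chil : chi < lambda by have : chi <= chi0 := omin_le wfO Qchi0; ord.
have lth := infinite_cardinal_limit rth.1.
have thchi : theta < chi.
  apply: neg_lt => h; apply: nchi; apply: subset_card_le => x; rewrite /pre/=; ord.
have ichi : infinite_cardinal chi.
  split; first by move=> c cc h; apply: nchi; apply: card_le_trans h _; exact: chimin.
  move=> f; apply: rth.1.2; apply: card_le_finite f.
  by apply: subset_card_le => x; rewrite /pre/=; ord.
have lchi := infinite_cardinal_limit ichi.
have thl : theta < lambda by ord.
(* Regularity of [chi]: a union of at most [theta] ordinals of size at most [theta] is covered by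
   pairs below [theta]. *)
have small_chi B : B #<= pre theta -> small chi B.
  move=> Bth f fc; apply: contrapT => no; apply: nchi.
  apply: card_le_trans (infinite_cardinal_prod wfO rth.1).
  have [u uP] := card_leS \bot Bth.
  have /boolp.choice[v vP] : forall p, exists v : O -> O, B p ->
      forall x, x < f p -> exists2 k, k < theta & v k = x.
    move=> p; have [Bp|] := pselect (B p); last by exists id.
    by have [v vP] := card_leS \bot (chimin _ (fc p Bp)); exists v.
  apply: (@card_le_surj _ _ _ _ (fun q => v (u q.1) q.2)) => x xc.
  have [p Bp xf] : exists2 p, B p & x < f p.
    apply: contrapT => no'; apply: no; exists x => // p Bp.
    by apply: neg_le => xf; apply: no'; exists p.
  have [i it ui] := uP p Bp; have [k kt vk] := vP p Bp x xf.
  by exists (i, k) => //=; rewrite ui.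
pose good mu (f : O -> O) := [/\ forall x y, x < y -> y < theta -> f x < f y,
   forall x, x < theta -> f x < mu & forall x, x < mu -> exists2 i, i < theta & x < f i].
have /boolp.choice[f fP] : forall mu, exists f, (exists f', good mu f') -> good mu f.
  move=> mu; have [[f gf]|] := pselect (exists f', good mu f'); last by exists id.
  by exists f.
pose Rich E mu := [/\ mu < lambda, good mu (f mu) & forall x, x < mu -> exists2 z, E z & x < z < mu].
have [|E E' mu EE [mul gmu h]|E mu []|E cE|E D mu cE [mul [fm fmu fc] h]|s sP] :=
  @guessing_ranks lambda chi theta O (pre lambda) (fun mu => f mu @` pre theta) Rich rl chil lchi; last 1 first.
- exists s => X cX; have [//|y yl yP] := sP (fun=> X); exists y => // t tt.
  have ts := osucc_gt wfO tt; have ss := limit_osucc wfO lth tt.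
  exact: (yP 0%N).
- by move=> mu; apply: small_chi; exact: card_image_le.
- by split=> // x /h[z /EE Ez xz]; exists z.
- by [].
- have [h hE hm] : exists2 h : O -> O, forall x, x < lambda -> E (h x) &
      forall x y, x < y -> y < lambda -> h x < h y.
    apply: (unb_enum wfO rl.1.2); split; first by case: cE.
    by move=> x /(club_unb cE)[y Ey xy]; exists y => //; exact: ltW.
  have [|x y xy yt|z [zl lz hz cz]] := seq_lim wfO (small_pre wfO rl.1 thl) lth (f := h).
  + by move=> x xt; apply: (club_lt cE); apply: hE; ord.
  + by apply: hm => //; ord.
  exists z; split=> //.
    by apply: fP; exists h; split=> // x y xy yt; apply: hm => //; ord.
  move=> x /cz[i it xh]; exists (h i); first by apply: hE; ord.
  by rewrite xh hz.
(* The last points of [E] for the sequence [f mu] are cofinal in [mu], so regularity of [theta]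
   makes their type at least [theta]. *)
pose B := [set z | exists2 x, (f mu @` pre theta) x & last_in E x z].
have Bmu : B `<=` pre mu.
  by move=> z [_ [i it <-] [_ zf _]]; rewrite /pre/=; have := fmu i it; ord.
have Bc x : x < mu -> exists2 z, B z & x < z.
  move=> /h[w [Ew _] /andP[xw wmu]].
  have [i it wf] := fc w wmu.
  have [||z lz] := last_in_ex cE _ Ew _ (ltW wf).
  - by have := fmu i it; ord.
  - by have := le0x x; ord.
  exists z; first by exists (f mu i) => //; exists i.
  by case: lz => _ _ /(_ w Ew (ltW wf)); ord.
have [b _ [u [uB um]]] := otp_exists wfO Bmu.
have thb : theta <= b.
  apply: neg_le => bth.
  have /boolp.choice[k kP] : forall j, exists k, j < b -> k < theta /\ u j <= f mu k.
    move=> j; have [jb|] := ltP j b; last by exists \bot; ord.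
    have : B (u j) by rewrite -uB; exists j.
    by move=> [_ [k kt <-] [_ ? _]]; exists k.
  have [|k0 k0t k0P] := small_pre wfO rth bth (f := k); first by move=> j /kP[].
  have [z Bz fz] := Bc _ (fmu _ k0t); move: Bz; rewrite -uB => -[j jb uj].
  have [kt uk] := kP j jb; have := k0P j jb; rewrite le_eqVlt => /orP[/eqP kk|kk].
    by rewrite kk in uk; ord.
  by have := fm _ _ kk k0t; ord.
exists u => [x y xy yt|i it]; first by apply: um => //; ord.
suff [x ? ?] : B (u i) by exists x.
by rewrite -uB; exists i => //; rewrite /pre/=; ord.
Qed.

End ClubGuessing.

(** * Projections of successors of uncountable cardinals *)

Section SuccessorProjections.
Variables (d : Order.disp_t) (O : bOrderType d).
Hypothesis wfO : well_ordered O.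
Implicit Types (a b c x y z : O) (A B D X E S : set O).

(* The ordinals below [lambda] of cofinality at least [theta]. *)
Definition high_cof (theta lambda : O) : set O :=
  [set z | [/\ z < lambda, limit z & forall r, r < theta -> small z (pre r)]].

Lemma club_enum lambda E : regular_uncountable lambda -> club lambda E ->
  exists2 h : O -> O, forall x, x < lambda -> E (h x) &
    forall x y, x < y -> y < lambda -> h x < h y.
Proof.
move=> rl cE; apply: (unb_enum wfO rl.1.2); split; first by case: cE.
by move=> x /(club_unb cE)[y Ey xy]; exists y => //; exact: ltW.
Qed.

Lemma stat_high_cof lambda theta : regular_uncountable lambda -> regular theta ->
  theta < lambda -> stat lambda (high_cof theta lambda).
Proof.
move=> rl rth thl D cD; have [h hD hm] := club_enum rl cD.
have lth := infinite_cardinal_limit rth.1.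
have hmt x y : x < y -> y < theta -> h x < h y by move=> xy yt; apply: hm => //; ord.
have [|z [zl lz hz cz]] := seq_lim wfO (small_pre wfO rl.1 thl) lth (f := h) _ hmt.
  by move=> x xt; apply: (club_lt cD); apply: hD; ord.
exists z; last first.
  apply: (club_closed cD) => //; first by case: lz.
  move=> x /cz[i it xi]; exists (h i); first by apply: hD; ord.
  by rewrite xi hz.
split=> // r rt f fz.
have /boolp.choice[k kP] : forall p, exists k, p < r -> k < theta /\ f p < h k.
  move=> p; have [pr|] := ltP p r; last by exists \bot; ord.
  by have [k kt fk] := cz _ (fz p pr); exists k.
have [|k0 k0t k0P] := small_pre wfO rth rt (f := k); first by move=> p /kP[].
exists (h k0); first exact: hz.
move=> p pr; have [kt fk] := kP p pr; have := k0P p pr.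
rewrite le_eqVlt => /orP[/eqP <-|kk]; first exact: ltW.
by have := hmt _ _ kk k0t; ord.
Qed.

(* [C b] consists of the records of an enumeration of [b] of type [theta]: fewer
   than [theta] of them lie below [de < b], so they do not accumulate at [de]. *)
Lemma record_walks lambda theta : (forall a, a < lambda -> pre a #<= pre theta) ->
  exists C : O -> set O, forall de b, high_cof theta lambda de -> b < lambda -> de <= b ->
    exists n g, g < de /\ forall j, g <= j -> j < de -> walk C n j b = de.
Proof.
move=> hle.
have /boolp.choice[p pP] : forall b, exists p : O -> O, b < lambda ->
    forall x, x < b -> exists2 i, i < theta & p i = x.
  move=> b; have [bl|] := ltP b lambda; last by exists id; ord.
  by have [p pP] := card_leS \bot (hle b bl); exists p.
pose C b := [set z | z < b /\ exists i, [/\ i < theta, z = p b i &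
  forall k, k < i -> p b k < b -> p b k < p b i]].
have cofC b : b < lambda -> cofinal b (C b).
  move=> bl; split=> [x []//|x xb].
  pose Q := [set i | i < theta /\ x <= p b i < b].
  have [i0 it0 pi0] := pP b bl x xb.
  have Qi0 : Q i0 by split=> //; rewrite pi0 lexx xb.
  have [it /andP[xi ib]] : Q (omin Q) := omin_in wfO Qi0.
  exists (p b (omin Q)) => //; split=> //; exists (omin Q); split=> // k ki kb.
  suff : ~ (x <= p b k) by ord.
  move=> xk; suff : omin Q <= k by ord.
  by apply: (omin_le wfO); split; [ord|rewrite xk].
exists C => de b [del lde sde] bl deb.
have [n [g [gde [h|[e [dee el _ eC]]]]]] := walk_to wfO cofC lde bl deb; first by exists n, g.
exfalso.
(* From the first enumerated element of [e] at or above [de] onwards, no record lies below [de]. *)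
pose Q := [set i | i < theta /\ de <= p e i < e].
have [i0 it0 pi0] := pP e el de dee.
have Qi0 : Q i0 by split=> //; rewrite pi0 lexx dee.
have [it /andP[dei ie]] : Q (omin Q) := omin_in wfO Qi0.
have [||be bede beP] := sde (omin Q) _ (fun i => if p e i < de then p e i else \bot).
- by [].
- by move=> i _; case: ifP => // _; case: lde.
have [c [ce [i [ith ci rec]]] /andP[bc cde]] := eC be bede.
have ii : i < omin Q.
  apply: neg_lt; rewrite le_eqVlt => /orP[/eqP qi|qi].
    by rewrite qi in dei; ord.
  by have := rec _ qi ie; ord.
by have := beP i ii; rewrite -ci cde; ord.
Qed.

(** For this ideal the positive fibres given by [nontrivial_walks] are stationary subsets of [S]. *)
Lemma nonstationary_uniform lambda S : regular_uncountable lambda -> stat lambda S ->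
  uniform_ideal lambda [set A | A `<=` pre lambda /\ ~ stat lambda (S `&` A)].
Proof.
move=> rl sS.
set I := [set A | _].
have clU (T : Type) (W : set T) : small lambda W -> closed_union I W.
  move=> sW A AI; split; first by move=> x [p /AI[Al _] /Al].
  move=> sU; have [|p Wp sp] := stat_bigcup wfO rl sW sU (A := A).
    by move=> x [_ [p Wp Ap]] _; exists p.
  have [_] := AI p Wp; apply; apply: stat_sub sp => x [[Sx _] Ax]; by split.
split.
- split.
    split=> [A []//| |A B BA [Al nA]|A B IA IB].
    + by split=> // s0; have [x []] := s0 _ (club_limit wfO rl).
    + split; first exact: subset_trans Al.
      by move=> sB; apply: nA; apply: stat_sub sB => x [Sx /BA].
    + suff -> : A `|` B = \bigcup_(t in [set: bool]) (if t then A else B).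
        by apply: (clU bool setT (@small_bool _ O lambda) (fun t => if t then A else B)) => -[].
      apply/seteqP; split=> x; first by case; [exists true|exists false].
      by case=> -[] _ ?; [left|right].
  move=> [_]; apply; apply: stat_sub (statI wfO rl sS (cubf_club (club_limit wfO rl))).
  by move=> x [Sx [xl _]].
- by move=> T W lW; apply: clU; apply: (small_card wfO) => //; case: rl => -[].
move=> A [Al [b bl Ab]]; split=> // sA.
by have [y [Sy /Ab yb] /andP[]] := stat_unb wfO rl sA bl; ord.
Qed.

(** The values that a walk takes stationarily often on [S] are unbounded, hence enumerated in type
    [lambda]; triples are coded by these values through the pairing. This partitions stationary sets
    without Solovay's theorem. *)
Lemma stat_labels lambda S (C : O -> set O) : regular_uncountable lambda ->
  nontrivial lambda (pre lambda) C -> stat lambda S ->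
  exists label : O -> O * (O * O), forall p, p.1 < lambda -> p.2.1 < lambda -> p.2.2 < lambda ->
    stat lambda [set x | S x /\ label x = p].
Proof.
move=> rl nC sS; have gI := nonstationary_uniform rl sS.
have [n [j [jl nj]]] := nontrivial_walks wfO rl nC gI.
pose X := [set xi | xi < lambda /\ stat lambda [set b | S b /\ walk C n j b = xi]].
have cX : cofinal lambda X.
  split=> [x []//|x /nj[xi /andP[xxi xil] nI]]; exists xi => //; split=> //.
  apply: contrapT => ns; apply: nI; split; first by move=> b [].
  by move=> s; apply: ns; apply: stat_sub s => b [Sb []].
have [e eX em] := unb_enum wfO rl.1.2 cX.
have [g [gl gi]] := pairing wfO rl.1.1.
pose code (p : O * (O * O)) := e (g p.1 (g p.2.1 p.2.2)).
pose ok (p : O * (O * O)) := [/\ p.1 < lambda, p.2.1 < lambda & p.2.2 < lambda].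
have code_inj p q : ok p -> ok q -> code p = code q -> p = q.
  case: p q => [p1 [p2 p3]] [q1 [q2 q3]] [/= a1 a2 a3] [/= b1 b2 b3].
  have ga := gl _ _ a2 a3; have gb := gl _ _ b2 b3.
  move=> /(incr_inj em (gl _ _ a1 ga) (gl _ _ b1 gb)) h.
  have [-> h'] := gi _ _ _ _ a1 ga b1 gb h.
  by have [-> ->] := gi _ _ _ _ a2 a3 b2 b3 h'.
have /boolp.choice[label lP] : forall b, exists p, forall q, ok q -> code q = walk C n j b -> q = p.
  move=> b; have [[p [okp cp]]|no] := pselect (exists p, ok p /\ code p = walk C n j b).
    by exists p => q okq cq; apply: code_inj => //; rewrite cq.
  by exists (\bot, (\bot, \bot)) => q okq cq; case: no; exists q.
exists label => p p1 p2 p3; have okp : ok p by [].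
have [_] : X (code p) by apply: eX; apply: (gl) => //; exact: gl.
by apply: stat_sub => b [Sb wb]; split=> //; rewrite -(lP b p).
Qed.

(** Here [chi] is [theta] itself, so the guessed sets must have fewer than [theta] elements:
    [e (xi, mu)] consists of the first [xi] entries of an enumeration of [mu]. As [theta] is
    regular, [sigma] many points of a club below [mu] appear within some such [xi]. *)
Lemma guess_small_ordertype lambda theta sigma : regular_uncountable lambda -> regular theta ->
  theta < lambda -> (forall a, a < lambda -> pre a #<= pre theta) -> sigma < theta ->
  exists s : O * O -> O -> O, forall X : nat -> set O, (forall n, cofinal lambda (X n)) ->
    exists2 y, y.1 < lambda /\ y.2 < lambda & forall n t, t < osucc t -> osucc t < sigma ->
      exists2 x, X n x & rank_in (s y) x = t.
Proof.
move=> rl rth thl hle st; have lth := infinite_cardinal_limit rth.1.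
have /boolp.choice[p pP] : forall b, exists p : O -> O, b < lambda ->
    forall x, x < b -> exists2 i, i < theta & p i = x.
  move=> b; have [bl|] := ltP b lambda; last by exists id; ord.
  by have [p pP] := card_leS \bot (hle b bl); exists p.
pose e (y : O * O) := [set z | y.1 < theta /\ (p y.2 @` pre y.1) z].
pose Rich E (y : O * O) := [/\ y.1 < theta, y.2 < lambda & exists2 s : O -> O,
   forall x z, x < z -> z < sigma -> s x < s z & forall i, i < sigma -> E (s i) /\ e y (s i)].
apply: (@guessing_ranks _ _ wfO lambda theta sigma (O * O) [set y | y.1 < lambda /\ y.2 < lambda] e Rich) => //.
- move=> [xi mu]; have [xt|tx] := ltP xi theta; last first.
    by move=> f _; exists \bot; [case: lth|move=> x [/= + _]; ord].
  apply: (@small_sub _ _ _ _ _ (p mu @` pre xi)); [by move=> z []|by case: lth|].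
  by apply: small_image; exact: (small_pre wfO).
- move=> E E' y EE [yt yl [s sm sE]]; split=> //; exists s => // i /sE[/EE ? ?]; by split.
- by move=> E y [yt yl _]; split=> //; ord.
- move=> E cE; have [h hE hm] := club_enum rl cE.
  have sl : sigma < lambda by ord.
  pose mu := h sigma; have mul : mu < lambda by exact: (club_lt cE (hE _ sl)).
  have /boolp.choice[k kP] : forall i, exists k, i < sigma -> k < theta /\ p mu k = h i.
    move=> i; have [isg|] := ltP i sigma; last by exists \bot; ord.
    by have [k kt pk] := pP mu mul (h i) (hm _ _ isg sl); exists k.
  have [|k0 k0t k0P] := small_pre wfO rth st (f := k); first by move=> i /kP[].
  have k0s := osucc_gt wfO k0t; have k0st := limit_osucc wfO lth k0t.
  exists (osucc k0, mu); split=> //; exists h => [x z xz zs|i isg].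
    by apply: hm => //; ord.
  split; first by apply: hE; ord.
  split=> //; have [kt pk] := kP i isg; exists (k i) => //.
  by have := k0P i isg; rewrite /pre/=; ord.
move=> E D y cE [yt yl [s sm sE]]; by exists s => // i /sE[[Es _] es]; exists (s i).
Qed.

(* Only countably many numbers [n] of steps occur, so if for every [n] some
   colours [t n zeta] were omitted, a single label [y] whose guess covers all
   [t n] would contradict the number of steps assigned to it. *)
Lemma projections_successor lambda theta (C' : O -> set O) :
  regular_uncountable lambda -> regular theta -> ~ countable (pre theta) ->
  theta < lambda -> (forall a, a < lambda -> pre a #<= pre theta) ->
  nontrivial lambda (pre lambda) C' ->
  exists g : nat * (O * O) -> O -> O, forall X, cofinal lambda X ->
    exists2 p, p.2.1 < lambda /\ p.2.2 < lambda &
      forall t, t < theta -> exists2 x, X x & g p x = t.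
Proof.
move=> rl rth uth thl hle nC'; have lth := infinite_cardinal_limit rth.1.
have ll := regular_limit rl.
set S := high_cof theta lambda; have sS : stat lambda S by exact: stat_high_cof.
have [C CP] := record_walks hle.
have [label lS] := stat_labels rl nC' sS.
have /boolp.choice[s sP] : forall sigma, exists s : O * O -> O -> O, sigma < theta ->
   forall X : nat -> set O, (forall n, cofinal lambda (X n)) ->
    exists2 y, y.1 < lambda /\ y.2 < lambda & forall n t, t < osucc t -> osucc t < sigma ->
      exists2 x, X n x & rank_in (s y) x = t.
  move=> sigma; have [st|] := ltP sigma theta; last by exists (fun _ x => x); ord.
  by have [s sP] := guess_small_ordertype rl rth thl hle st; exists s.
pose f z (y : O * (O * O)) := rank_in (s y.1 y.2) z.
exists (fun p b => f p.2.2 (label (walk C p.1 p.2.1 b))) => X cX.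
have /boolp.choice[w wP] : forall de, exists w : nat * (O * O), S de ->
    [/\ w.2.1 < de, X w.2.2, de <= w.2.2 &
       forall j, w.2.1 <= j -> j < de -> walk C w.1 j w.2.2 = de].
  move=> de; have [Sde|] := pselect (S de); last by exists (0%N, (\bot, \bot)).
  have [del _ _] := Sde; have [b Xb deb] := cX.2 _ del.
  by have [n [g [gde h]]] := CP de b Sde (cX.1 _ Xb) deb; exists (n, (g, b)).
pose ok (p : O * (O * O)) := [/\ p.1 < lambda, p.2.1 < lambda & p.2.2 < lambda].
(* Pressing down fixes, for each label [y], the number of steps and the threshold for targets on a
   stationary set. *)
have /boolp.choice[v vP] : forall y : O * (O * O), exists v : nat * O, ok y ->
    v.2 < lambda /\ stat lambda [set de | [/\ S de, label de = y, (w de).1 = v.1 & (w de).2.1 = v.2]].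
  move=> y; have [oky|] := pselect (ok y); last by exists (0%N, \bot).
  have sy : stat lambda [set x | S x /\ label x = y] by case: oky => *; exact: lS.
  have [|n _ sn] := stat_bigcup wfO rl (small_nat wfO rl) sy (A := fun n => [set de | (w de).1 = n]).
    by move=> x _ _; exists (w x).1.
  have [|g gl sg] := Fodor wfO rl sn (f := fun de => (w de).2.1).
    by move=> x [[Sx _] _] _; have [] := wP x Sx.
  by exists (n, g); split=> //; apply: stat_sub sg => x [[[Sx lx] wx] gx].
have [n [z [zl nzP]]] : exists n z, z < lambda /\
    forall t, t < theta -> exists y : O * (O * O), [/\ ok y, (v y).1 = n & f z y = t].
  apply: contrapT => no.
  have /boolp.choice[t tP] : forall p : nat * O, exists t, p.2 < lambda -> t < theta /\
      forall y : O * (O * O), ok y -> (v y).1 = p.1 -> f p.2 y <> t.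
    move=> [n z] /=; have [zl|] := ltP z lambda; last by exists \bot; ord.
    apply: contrapT => no'; apply: no; exists n, z; split=> // t tt.
    apply: contrapT => no2; apply: no'; exists t => _; split=> // y oky vy fy.
    by apply: no2; exists y.
  (* As [theta < lambda], some omitted colour is the same for cofinally many [z]. *)
  have /boolp.choice[tt ttP] : forall n, exists t0, t0 < theta /\
      cofinal lambda [set z | z < lambda /\ t (n, z) = t0].
    move=> n; apply: contrapT => no'.
    have /boolp.choice[b bP] : forall t0, exists b, t0 < theta -> b < lambda /\
        forall z, z < lambda -> t (n, z) = t0 -> z < b.
      move=> t0; have [tt0|] := ltP t0 theta; last by exists \bot; ord.
      apply: contrapT => no2; apply: no'; exists t0; split=> //; split=> [x []//|x xl].
      apply: contrapT => no3; apply: no2; exists x => _; split=> // z zl tz.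
      by apply: neg_lt => xz; apply: no3; exists z.
    have [|be bel beP] := small_pre wfO rl.1 thl (f := b); first by move=> t0 /bP[].
    have [tt0 _] := tP (n, be) bel.
    by have [_ /(_ be bel erefl)] := bP _ tt0; have := beP _ tt0; ord.
  have rut : regular_uncountable theta by [].
  (* Uncountability of [theta] bounds all [tt n]. The guess has type two successors above the bound,
     since rank [t] requires [osucc t < sigma]. *)
  have [|t0 t0t t0P] := small_nat wfO rut (f := tt); first by move=> n _; have [] := ttP n.
  have t1 := limit_osucc wfO lth t0t; have t2 := limit_osucc wfO lth t1.
  have u1 := osucc_gt wfO t0t; have u2 := osucc_gt wfO t1.
  have [|[xi mu] [/= xil mul] yP] := sP _ t2 (fun n => [set z | z < lambda /\ t (n, z) = tt n]).
    by move=> n; have [] := ttP n.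
  pose y := (osucc (osucc t0), (xi, mu)).
  have oky : ok y by split=> //=; ord.
  set n := (v y).1.
  have tn : tt n <= t0 by exact: t0P.
  have tnt : tt n < theta by ord.
  have [||z [zl tz] rz] := yP n (tt n); first exact: (osucc_gt wfO tnt).
    move: tn; rewrite le_eqVlt => /orP[/eqP ->//|/(osucc_le wfO)]; ord.
  have [_ /(_ y oky erefl)] := tP (n, z) zl; apply.
  by rewrite tz.
have /boolp.choice[y yP] : forall t, exists y : O * (O * O), t < theta -> [/\ ok y, (v y).1 = n & f z y = t].
  move=> t; have [/nzP[y]|] := ltP t theta; first by exists y.
  by exists (\bot, (\bot, \bot)); ord.
(* One target [g] serves all [theta] labels: each label still occurs at some [de > g], which is
   reached from a member of [X]. *)
have [|g gl gP] := small_pre wfO rl.1 thl (f := fun t => (v (y t)).2).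
  by move=> t tt; have [/vP[]] := yP t tt.
exists (n, (g, z)) => //= t tt; have [oky vy fy] := yP t tt.
have [_ sy] := vP _ oky.
have [de [Sde lde wn wg] /andP[gde _]] := stat_unb wfO rl sy gl.
have [wde Xw dew walkde] := wP de Sde.
exists (w de).2.2 => //; rewrite -vy -wn walkde ?lde//.
by rewrite wg; exact: gP.
Qed.

End SuccessorProjections.

(** * Projections of the first uncountable cardinal *)

Section Oscillation.
Variables (d : Order.disp_t) (O : bOrderType d).
Hypothesis wfO : well_ordered O.
Implicit Types (a b c x y z de : O) (A B D X E S P Q : set O).

Lemma least_nat (R : nat -> Prop) : (exists n, R n) ->
  exists n, R n /\ forall m, R m -> (n <= m)%N.
Proof.
move=> [n Rn]; have ex : exists m, `[< R m >] by exists n; apply/asboolP.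
case: (ex_minnP ex) => m /asboolP Rm mm; exists m; split=> // k Rk.
exact/mm/asboolP.
Qed.

Lemma ladder_exists a : limit a -> countable (pre a) -> exists l : nat -> O,
  [/\ forall m, l m < a, forall m n, (m <= n)%N -> l m <= l n &
      forall x, x < a -> exists m, x < l m].
Proof.
move=> la /(card_leS \bot)[en0 en0P].
pose en n := if en0 n < a then en0 n else \bot.
have ena n : en n < a by rewrite /en; case: ifP => // _; case: la.
pose l := fix l m := if m is m'.+1 then Order.max (l m') (en m) else en 0%N.
have lS m : l m <= l m.+1 by rewrite /= le_max lexx.
have enl m : en m <= l m by case: m => //= m; rewrite le_max lexx orbT.
exists l; split.
- by elim=> //= m IH; rewrite gt_max IH ena.
- move=> m; elim=> [|n IH]; first by rewrite leqn0 => /eqP ->.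
  by rewrite leq_eqVlt => /orP[/eqP ->//|/IH]; have := lS n; ord.
move=> x xa; have sa := limit_osucc wfO la xa; have xs := osucc_gt wfO xa.
have [n _ nE] := en0P _ sa; exists n.
by have := enl n; rewrite /en nE sa; ord.
Qed.

Section Fix_lambda.
Variable lambda : O.
Hypothesis rl : regular_uncountable lambda.
Variable L : O -> nat -> O.
Hypothesis LP : forall a, a < lambda -> limit a ->
  [/\ forall m, L a m < a, forall m n, (m <= n)%N -> L a m <= L a n &
      forall x, x < a -> exists m, x < L a m].

Section Fix_P.
Variable P : set O.

Hypothesis Plim : forall x, P x -> x < lambda /\ limit x.

Definition wide Q m : Prop := forall x, x < lambda -> exists2 xi, x <= xi < lambda &
  stat lambda [set de | Q de /\ L de m = xi].

Lemma ladder_Fodor Q m : Q `<=` P -> stat lambda Q ->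
  exists2 c, c < lambda & stat lambda [set de | Q de /\ L de m = c].
Proof.
move=> QP sQ; apply: (Fodor wfO rl sQ) => x Qx xl.
by have [_ lx] := Plim (QP x Qx); have [+ _ _] := LP xl lx; exact.
Qed.

(** Let [b0] bound the bounds [b m] for all [m]. Above [b0], some fixed ladder entry is stationarily
    often at least [b m], and pressing down makes it constant there, a contradiction. *)
Lemma wide_ex Q : Q `<=` P -> stat lambda Q -> exists m, wide Q m.
Proof.
move=> QP sQ; apply: contrapT => no.
have /boolp.choice[b bP] : forall m, exists b, b < lambda /\ forall xi, b <= xi -> xi < lambda ->
    ~ stat lambda [set de | Q de /\ L de m = xi].
  move=> m; apply: contrapT => no'; apply: no; exists m => x xl.
  apply: contrapT => no2; apply: no'; exists x; split=> // xi xxi xil sxi.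
  by apply: no2; exists xi => //; rewrite xxi.
have [|b0 b0l b0P] := small_nat wfO rl (f := b); first by move=> m _; have [] := bP m.
have sQ' := statI wfO rl sQ (cubf_club (club_gt wfO rl b0l)).
have [|m _ sm] := stat_bigcup wfO rl (small_nat wfO rl) sQ' (A := fun m => [set de | b m <= L de m]).
  move=> x [Qx [_ bx]] xl; have [_ lx] := Plim (QP x Qx).
  have [_ _ Lc] := LP xl lx; have [m bm] := Lc _ bx; exists m => //=.
  by have := b0P m Logic.I; ord.
have [|c cl sc] := ladder_Fodor m _ sm; first by move=> x [[Qx _] _]; exact: QP.
have [x [[[Qx _] /= bx] Lx] _] := sc _ (club_limit wfO rl).
have [_ /(_ c)] := bP m; apply => //; first by rewrite -Lx.
by apply: stat_sub sc => y [[[Qy _] _] Ly].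
Qed.

Lemma wide_stat Q m : wide Q m -> stat lambda Q.
Proof.
move=> /(_ _ (regular_bot rl))[xi _]; apply: stat_sub => x; by case.
Qed.

Lemma wide_sub Q Q' m : Q `<=` Q' -> wide Q m -> wide Q' m.
Proof.
move=> QQ wQ x /wQ[xi xxi sxi]; exists xi => //.
by apply: stat_sub sxi => y [/QQ].
Qed.

(** Initial words of the ladders form a tree; [splits] marks the nodes with unboundedly many
    stationary immediate continuations. *)
Definition node (s : seq O) : set O := [set de | P de /\ mkseq (L de) (size s) = s].
Definition splits (s : seq O) : Prop := wide (node s) (size s).

Lemma node_rcons s x de : node s de -> L de (size s) = x -> node (rcons s x) de.
Proof. by move=> [Pde ms] Lx; split=> //; rewrite size_rcons mkseqS ms Lx. Qed.

(** Choose the least [m] that is wide for some subset of the node. Entries before [m] are then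
    bounded on stationary sets, so they can be made constant one at a time, by pressing down and a
    pigeonhole, keeping [m] wide. What is left lies in a single node of length [m]. *)
Lemma splits_ext t : stat lambda (node t) -> exists u, splits (t ++ u).
Proof.
move=> st; have tP : node t `<=` P by move=> x [].
have [m [[Q [Qt wQ]] mmin]] : exists m, (exists Q, Q `<=` node t /\ wide Q m) /\
    forall m', (exists Q, Q `<=` node t /\ wide Q m') -> (m <= m')%N.
  by apply: (@least_nat (fun m => exists Q, Q `<=` node t /\ wide Q m)); have [m wm] := wide_ex tP st; exists m, (node t); split.
have tm : (size t <= m)%N.
  rewrite leqNgt; apply/negP => mt.
  have nl : nth \bot t m < lambda.
    have [x [[Px tx] _] _] := stat_cubf st (cubf_club (club_limit wfO rl)).
    have [xl lx] := Plim Px; have [Lx _ _] := LP xl lx.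
    by rewrite -tx nth_mkseq//; have := Lx m; ord.
  have [xi /andP[nxi xil] sxi] := wQ _ (limit_osucc wfO (regular_limit rl) nl).
  have [x [[/Qt[Px tx] Lx] _ _]] := stat_cubf sxi (cubf_club (club_limit wfO rl)).
  have := osucc_gt wfO nl; move: nxi; rewrite -Lx -{1 2 3}tx nth_mkseq//; ord.
have key k : (k <= m)%N -> exists s Q', [/\ size s = k, Q' `<=` Q, Q' `<=` node s & wide Q' m].
  elim: k => [_|k IH km].
    by exists [::], Q; split=> // x /Qt[Px _]; split.
  have [s [Q' [sk QQ Qs wQ']]] := IH (ltnW km).
  have [b [bl bP]] : exists b, b < lambda /\ forall xi, b <= xi -> xi < lambda ->
      ~ stat lambda [set de | Q' de /\ L de k = xi].
    apply: contrapT => no; suff : (m <= k)%N by rewrite leqNgt km.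
    apply: mmin; exists Q'; split; first exact: subset_trans Qt.
    move=> x xl; apply: contrapT => no'; apply: no; exists x; split=> // xi xxi xil sxi.
    by apply: no'; exists xi => //; rewrite xxi.
  have fib x : x < lambda -> exists c xi, [/\ c < b, x <= xi, xi < lambda &
      stat lambda [set de | [/\ Q' de, L de k = c & L de m = xi]]].
    move=> /wQ'[xi /andP[xxi xil] sxi].
    have [|c cl sc] := ladder_Fodor k _ sxi; first by move=> y [/Qs[]].
    exists c, xi; split=> //; last by apply: stat_sub sc => y [[]].
    apply: neg_lt => bc; apply: (bP c bc cl).
    by apply: stat_sub sc => y [[]].
  have [c [cb wc]] : exists c, c < b /\ forall x, x < lambda -> exists2 xi, x <= xi < lambda &
      stat lambda [set de | [/\ Q' de, L de k = c & L de m = xi]].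
    apply: contrapT => no.
    have /boolp.choice[h hP] : forall c, exists x, c < b -> x < lambda /\
        forall xi, x <= xi -> xi < lambda -> ~ stat lambda [set de | [/\ Q' de, L de k = c & L de m = xi]].
      move=> c; have [cb|] := ltP c b; last by exists \bot; ord.
      apply: contrapT => no'; apply: no; exists c; split=> // x xl.
      apply: contrapT => no2; apply: no'; exists x => _; split=> // xi xxi xil sxi.
      by apply: no2; exists xi => //; rewrite xxi.
    have [|x xl xP] := small_pre wfO rl.1 bl (f := h); first by move=> c /hP[].
    have [c [xi [cb xxi xil sxi]]] := fib x xl; have [_ /(_ xi)] := hP c cb.
    by have := xP c cb => hx; apply => //; ord.
  exists (rcons s c), [set de | Q' de /\ L de k = c]; split.
  - by rewrite size_rcons sk.
  - by move=> x [/QQ].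
  - by move=> x [/Qs nx Lx]; apply: node_rcons => //; rewrite sk.
  - by move=> x /wc[xi xxi sxi]; exists xi => //; apply: stat_sub sxi => y [].
have [s [Q' [sm QQ Qs wQ']]] := key m (leqnn m).
have [x [/[dup] /Qs[Px sx] /QQ/Qt[_ tx] _ _]] :=
  stat_cubf (wide_stat wQ') (cubf_club (club_limit wfO rl)).
exists (drop (size t) s); suff -> : t ++ drop (size t) s = s.
  by rewrite /splits sm; exact: wide_sub wQ'.
rewrite -[RHS](cat_take_drop (size t)); congr (_ ++ _).
by rewrite -sx sm -{1}tx /mkseq -map_take take_iota; congr map; congr iota; exact/esym/minn_idPl.
Qed.

Lemma splits_next s x : splits s -> x < lambda -> exists xi u b,
  [/\ splits (s ++ xi :: u), x <= xi, b < lambda & forall y, y \in s ++ xi :: u -> y < b].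
Proof.
move=> ss xl; have [xi /andP[xxi xil] sxi] := ss x xl.
have [|u su] := @splits_ext (rcons s xi).
  by apply: stat_sub sxi => y [ny Ly]; exact: node_rcons.
rewrite cat_rcons in su.
have [b [[Pb sb] _ _]] := stat_cubf (wide_stat su) (cubf_club (club_limit wfO rl)).
have [bl lb] := Plim Pb; have [Lb _ _] := LP bl lb.
exists xi, u, b; split=> // y; rewrite -sb => /mapP[k _ ->]; exact: Lb.
Qed.

Lemma splits_sorted s xi u y : splits (s ++ xi :: u) -> y \in xi :: u -> xi <= y.
Proof.
move=> ss /(nthP \bot)[i iu <-].
have [x [[Px sx] _ _]] := stat_cubf (wide_stat ss) (cubf_club (club_limit wfO rl)).
have [xl lx] := Plim Px; have [_ Lm _] := LP xl lx.
have nE k : (k < size (xi :: u))%N -> nth \bot (xi :: u) k = L x (size s + k)%N.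
  move=> ku; have : nth \bot (s ++ xi :: u) (size s + k) = L x (size s + k)%N.
    by rewrite -sx nth_mkseq// size_cat ltn_add2l.
  by rewrite nth_cat ltnNge leq_addr /= addKn.
by rewrite (nE i iu); have /= -> := nE 0%N isT; rewrite Lm// leq_add2l.
Qed.

End Fix_P.

(* The interval from [L j k] to [L j k.+1] has index [k.+1]. *)
Definition interval_index j x : nat :=
  xget 0%N [set k | x < L j k /\ forall k', x < L j k' -> (k <= k')%N].

Lemma interval_indexE j x k : j < lambda -> limit j -> L j k <= x -> x < L j k.+1 ->
  interval_index j x = k.+1.
Proof.
move=> jl lj h1 h2; have [_ Lm _] := LP jl lj.
have kP k' : x < L j k' -> (k.+1 <= k')%N.
  by move=> h; rewrite ltnNge; apply/negP => /Lm; ord.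
apply: xget_unique => // k' [h3 /(_ _ h2) h4].
by apply/eqP; rewrite eqn_leq h4 kP.
Qed.

Lemma interval_index_le j x k : x < L j k -> (interval_index j x <= k)%N.
Proof.
move=> xk; have [n [nx nmin]] := @least_nat (fun k => x < L j k) (ex_intro _ k xk).
rewrite /interval_index; case: xgetP => [y _ [_]|/(_ n) []//]; exact.
Qed.

Definition intervals_met j (s : seq O) : nat := size (undup (map (interval_index j) s)).

(** The word that is read is the ladder of [de] before its first entry at or above [j]. *)
Definition oscillation j de : nat :=
  intervals_met j (mkseq (L de) (xget 0%N [set m | j <= L de m /\
     forall m', j <= L de m' -> (m <= m')%N])).

Lemma undup_cat_const (T : eqType) (s t : seq T) (v : T) : v \notin s -> t != [::] ->
  (forall y : T, y \in t -> y = v) -> size (undup (s ++ t)) = (size (undup s)).+1.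
Proof.
move=> vs t0 tv; have -> : (size (undup s)).+1 = size (undup (v :: s)).
  by rewrite /= (negbTE vs).
apply/perm_size/perm_undup => y; rewrite mem_cat inE orbC; congr orb.
apply/idP/eqP => [/tv //|->].
by case: t t0 tv => //= x t _ tv; rewrite -(tv x) ?inE ?eqxx.
Qed.

Lemma word_bound (s : seq O) z : limit z -> (forall y, y \in s -> y < z) ->
  exists2 x, x < z & forall y, y \in s -> y < x.
Proof.
move=> lz; elim: s => [|y s IH] sz; first by exists \bot; [case: lz|].
have [|x xz xP] := IH; first by move=> w ws; apply: sz; rewrite inE ws orbT.
have yz : y < z by apply: sz; rewrite inE eqxx.
have sy := limit_osucc wfO lz yz; have ys := osucc_gt wfO yz.
exists (Order.max (osucc y) x); first by rewrite gt_max sy.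
by move=> w; rewrite inE lt_max => /orP[/eqP ->|/xP ->]; rewrite ?ys ?orbT.
Qed.

(* A club point inside an interval of the ladder of [j] lets a word be prolonged
   so as to meet exactly one further interval. *)
Lemma stationary_oscillation P : stat lambda P -> (forall x, P x -> x < lambda /\ limit x) ->
  exists2 j, j < lambda & exists o, forall n, exists2 de, P de & oscillation j de = (o + n)%N.
Proof.
move=> sP Plim.
have /boolp.choice[N NP] : forall p : seq O * O, exists q : (O * seq O) * O, splits P p.1 -> p.2 < lambda ->
   [/\ splits P (p.1 ++ q.1.1 :: q.1.2), p.2 <= q.1.1, q.2 < lambda &
      forall y, y \in p.1 ++ q.1.1 :: q.1.2 -> y < q.2].
  move=> [s x] /=; have [[ss xl]|no] := pselect (splits P s /\ x < lambda); last first.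
    by exists ((\bot, [::]), \bot) => ss xl; case: no.
  by have [xi [u [b h]]] := splits_next Plim ss xl; exists ((xi, u), b).
have ll := regular_limit rl.
pose W z := [set s : seq O | forall x : O, x \in s -> pre z x] `*` pre z.
have /boolp.choice[F FP] : forall z, exists b, z < lambda -> b < lambda /\
    forall p, W z p -> splits P p.1 -> (N p).2 <= b.
  move=> z; have [zl|] := ltP z lambda; last by exists \bot; ord.
  have sz := small_pre wfO rl.1 zl.
  have [|b bl bP] := small_prod (small_words wfO rl sz) sz
     (f := fun p => if pselect (splits P p.1) is left _ then (N p).2 else \bot).
    move=> p [_ p2]; case: pselect => [ss|_]; last exact: regular_bot.
    by have [] // := NP p ss; rewrite /pre/= in p2; ord.
  exists b => _; split=> // p Wp ss; have := bP p Wp.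
  by case: pselect.
(* Below a point of this club, the prolongations chosen by [N] do not lead out of it. *)
have cK := cubfI wfO rl (cubf_club (club_limit wfO rl))
   (cubf_closed wfO rl (F := F) (fun z zl => (FP z zl).1)).
have [K cK' KP] := cK.
have Kclosed ga s x : K ga -> splits P s -> (forall y, y \in s -> y < ga) -> x < ga ->
    (N (s, x)).2 < ga.
  move=> /KP[[gal lga] [_ clF]] ss sga xga.
  have [z zga sz] := word_bound lga sga.
  have sx := limit_osucc wfO lga xga; have xs := osucc_gt wfO xga.
  have mga : Order.max z (osucc x) < ga by rewrite gt_max zga.
  have [_ /(_ (s, x))] := FP (Order.max z (osucc x)) (lt_trans mga gal).
  move=> /(_ _ ss) h; apply: le_lt_trans (clF _ mga); apply: h; split => /=.
    by move=> y /sz yz; rewrite /pre/= lt_max yz.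
  by rewrite /pre/= lt_max xs orbT.
have [s0 ss0] : exists s, splits P s.
  have [|u su] := @splits_ext P Plim [::]; last by exists u.
  by apply: stat_sub sP => x Px; split.
have Kunb x : x < lambda -> exists2 y, K y & x < y < lambda.
  by move=> xl; have [y Ky xy] := club_unb cK' xl; exists y => //; rewrite xy (club_lt cK' Ky).
have [b [[Pb s0b] _ _]] := stat_cubf (wide_stat ss0) (cubf_club (club_limit wfO rl)).
have [bl lb] := Plim _ Pb; have [Lb _ _] := LP bl lb.
have cj := cubfI wfO rl (cubf_club (club_acc wfO rl Kunb)) (cubf_club (club_limit wfO rl)).
have [j [[jl _ jK] [_ lj]] /andP[bj _]] := cubf_ex cj bl.
have [Lj Ljm Ljc] := LP jl lj.
exists j => //; exists (intervals_met j s0) => n.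
suff [s [ss sj <-]] : exists s, [/\ splits P s, forall y, y \in s -> y < j &
    intervals_met j s = (intervals_met j s0 + n)%N].
  (* The next ladder entry is taken at or above [j], so that [oscillation] reads exactly the word
     [s]. *)
  have [xi /andP[jxi xil] sxi] := ss j jl.
  have [de [[[Pde ms] Lde] _ _]] := stat_cubf sxi (cubf_club (club_limit wfO rl)).
  exists de => //; rewrite /oscillation (_ : xget _ _ = size s) ?ms//.
  have mins m' : j <= L de m' -> (size s <= m')%N.
    move=> h; rewrite leqNgt; apply/negP => lt.
    suff : L de m' < j by ord.
    by apply: sj; rewrite -ms; apply: map_f; rewrite mem_iota.
  apply: xget_unique; first by split; [rewrite Lde|].
  move=> m [h1 h2]; apply/eqP; rewrite eqn_leq mins// andbT; apply: h2.
  by rewrite Lde.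
elim: n => [|n [s [ss sj IH]]].
  exists s0; split=> //; last by rewrite addn0.
  by move=> y; rewrite -s0b => /mapP[k _ ->]; have := Lb k; ord.
have [z zj sz] := word_bound lj sj.
have [k1 zk1] := Ljc z zj.
have [ga Kga /andP[k1ga gaj]] := jK _ (Lj k1).
(* With [k = k2.+1], the prolongation starts at or above [L j k2], beyond all of [s], and stays
   below [ga <= L j k], hence inside one new interval. *)
have [k [gk kmin]] : exists k, ga <= L j k /\ forall k', ga <= L j k' -> (k <= k')%N.
  by apply: (@least_nat (fun k => ga <= L j k)); have [k gk] := Ljc ga gaj; exists k; exact: ltW.
have k1k : (k1 < k)%N by rewrite ltnNge; apply/negP => /Ljm; ord.
case: k k1k gk kmin => // k2 k12 gk kmin.
have k2ga : L j k2 < ga.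
  by apply: neg_lt => /kmin; rewrite ltnn.
have Lk12 : L j k1 <= L j k2 by exact: Ljm.
have sga y : y \in s -> y < ga by move=> /sz; ord.
have Nga := Kclosed ga s (L j k2) Kga ss sga k2ga.
have [|] := NP (s, L j k2) ss; first by rewrite /=; have := Lj k2; ord.
rewrite /=; set xi := (N _).1.1; set u := (N _).1.2 => ss' xik _ ub.
exists (s ++ xi :: u); split=> //; first by move=> y /ub; ord.
rewrite /intervals_met map_cat (@undup_cat_const _ _ _ k2.+1) ?addnS -?IH//.
  apply/negP => /mapP[y ys yk].
  have : y < L j k2 by have := sz y ys; ord.
  by move=> /interval_index_le; rewrite -yk ltnn.
move=> i /mapP[y yu ->]; apply: interval_indexE => //.
  by have := splits_sorted Plim ss' yu; ord.
by have := ub y; rewrite mem_cat yu orbT => /(_ isT); ord.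
Qed.

End Fix_lambda.

(** Pressing down fixes the number of steps and the target of the walks from [X] to a stationary set
    of [de]. Oscillation takes there all values from some [o] on; subtracting [o] and enumerating
    [theta] gives all colours. *)
Lemma projections_countable lambda theta : regular_uncountable lambda -> regular theta ->
  countable (pre theta) -> theta < lambda -> (forall a, a < lambda -> pre a #<= pre theta) ->
  exists g : (nat * O) * (nat * O) -> O -> O, forall X, cofinal lambda X ->
    exists2 p, p.1.2 < lambda /\ p.2.2 < lambda &
      forall t, t < theta -> exists2 x, X x & g p x = t.
Proof.
move=> rl rth cth thl hle.
have /boolp.choice[L LP] : forall a, exists l : nat -> O, a < lambda -> limit a ->
  [/\ forall m, l m < a, forall m n, (m <= n)%N -> l m <= l n &
      forall x, x < a -> exists m, x < l m].
  move=> a; have [[al la]|no] := pselect (a < lambda /\ limit a); last first.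
    by exists (fun=> \bot) => al la; case: no.
  have [l lP] := ladder_exists la (card_le_trans (hle a al) cth).
  by exists l.
have [en enP] := card_leS \bot cth.
have sS := stat_high_cof wfO rl rth thl.
have [C CP] := record_walks wfO hle.
exists (fun p b => en (oscillation L p.2.2 (walk C p.1.1 p.1.2 b) - p.2.1)%N) => X cX.
set S := high_cof theta lambda in sS CP.
have /boolp.choice[w wP] : forall de, exists w : nat * (O * O), S de ->
    [/\ w.2.1 < de, X w.2.2, de <= w.2.2 &
       forall j, w.2.1 <= j -> j < de -> walk C w.1 j w.2.2 = de].
  move=> de; have [Sde|] := pselect (S de); last by exists (0%N, (\bot, \bot)).
  have [del _ _] := Sde; have [b Xb deb] := cX.2 _ del.
  by have [n [g [gde h]]] := CP de b Sde (cX.1 _ Xb) deb; exists (n, (g, b)).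
have [|n _ sn] := stat_bigcup wfO rl (small_nat wfO rl) sS (A := fun n => [set de | (w de).1 = n]).
  by move=> x _ _; exists (w x).1.
have [|g gl sg] := Fodor wfO rl sn (f := fun de => (w de).2.1).
  by move=> x [Sx _] _; have [] := wP x Sx.
have [|j jl [o oP]] := stationary_oscillation rl LP sg.
  by move=> x [[[xl lx _] _] _].
exists ((n, g), (o, j)) => // t tt; have [k _ <-] := enP t tt.
have [de [[Sde wn] wg] osc] := oP k; have [wde Xw dew walkde] := wP de Sde.
exists (w de).2.2 => //=; rewrite -wn -wg walkde ?osc ?addKn//.
Qed.

End Oscillation.

(** * Conclusion *)

Section Conclusion.
Variables (d : Order.disp_t) (O : bOrderType d).
Hypothesis wfO : well_ordered O.
Implicit Types (kappa lambda theta : O).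

Lemma regular_lt_uncountable lambda theta : regular lambda -> regular theta ->
  theta < lambda -> regular_uncountable lambda.
Proof.
move=> rl rth thl; split=> // cl; apply: (rl.1.1 _ thl).
by apply: card_le_trans cl _; apply/infiniteP; case: rth => -[].
Qed.

Lemma projections kappa lambda theta (C : O -> set O) : regular_uncountable kappa ->
  lambda < kappa -> regular_uncountable lambda -> regular theta -> theta < lambda ->
  nontrivial lambda (pre lambda) C ->
  exists (P : Type) (W : set P) (g : P -> O -> O), small kappa W /\
    forall X, cofinal lambda X ->
      exists2 p, W p & forall t, t < theta -> exists2 x, X x & g p x = t.
Proof.
move=> rk lk rl rth thl nC; have k0 := regular_bot rk.
have sl := small_pre wfO rk.1 lk; have sn := small_nat wfO rk.
have [[chi chil nchi]|no] := pselect (exists2 chi, chi < lambda & ~ (pre chi #<= pre theta)).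
  have [s sP] := projections_large wfO rl rth chil nchi.
  by exists O, (pre lambda), (fun y x => rank_in (s y) x).
have hle a : a < lambda -> pre a #<= pre theta.
  by move=> al; apply: contrapT => na; apply: no; exists a.
have [cth|uth] := pselect (countable (pre theta)).
  have [g gP] := projections_countable wfO rl rth cth thl hle.
  exists ((nat * O) * (nat * O))%type, [set p | p.1.2 < lambda /\ p.2.2 < lambda], g.
  split=> //; apply: (@small_sub _ _ _ _ _ (([set: nat] `*` pre lambda) `*` ([set: nat] `*` pre lambda))) => //.
    by move=> [[n x] [m y]] [].
  by apply: small_prod => //; exact: small_prod.
have [g gP] := projections_successor wfO rl rth uth thl hle nC.
exists (nat * (O * O))%type, [set p | p.2.1 < lambda /\ p.2.2 < lambda], g.
split=> //; apply: (@small_sub _ _ _ _ _ ([set: nat] `*` (pre lambda `*` pre lambda))) => //.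
by apply: small_prod => //; exact: small_prod.
Qed.

Lemma not_greatly_Mahlo_coloring kappa lambda theta : regular_uncountable kappa ->
  lambda < kappa -> regular lambda -> regular theta -> theta < lambda ->
  ~ greatly_Mahlo lambda ->
  exists (P : Type) (W : set P) (c : P -> O -> O),
    [/\ small kappa W, forall p i, c p i < theta &
      forall I, uniform_ideal lambda I -> exists2 p, W p &
        forall tau, tau < theta -> ~ I [set i | i < lambda /\ c p i = tau]].
Proof.
move=> rk lk rgl rth thl nG; have rl := regular_lt_uncountable rgl rth thl.
have [C nC] := not_greatly_Mahlo_nontrivial wfO rl nG.
have [P [W [g [sW gP]]]] := projections rk lk rl rth thl nC.
have th0 : \bot < theta by case: (infinite_cardinal_limit rth.1).
exists ((nat * O) * P)%type, (([set: nat] `*` pre lambda) `*` W).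
exists (fun p i => if g p.2 (walk C p.1.1 p.1.2 i) < theta
                   then g p.2 (walk C p.1.1 p.1.2 i) else \bot); split.
- apply: small_prod => //; apply: small_prod; first exact: small_nat.
  exact: (small_pre wfO rk.1).
- by move=> p i; case: ifP.
move=> I gI; have [n [j [jl nj]]] := nontrivial_walks wfO rl nC gI.
have [|p Wp pP] := gP [set xi | xi < lambda /\ ~ I [set b | b < lambda /\ walk C n j b = xi]].
  split=> [x []//|x /nj[xi /andP[xxi xil] nI]]; by exists xi.
(* The fibre of [tau] contains the positive fibre of the walk over any [xi] that [g p] maps to
   [tau]. *)
exists ((n, j), p) => // tau taut nI; have [xi [xil nIxi] gxi] := pP tau taut.
apply: nIxi; apply: (uniform_sub gI _ nI) => b [bl wb]; split=> //=.
by rewrite wb gxi taut.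
Qed.

End Conclusion.

Theorem theoremC (d : Order.disp_t) (O : bOrderType d)
    (wfO : well_ordered O)
    (kappa lambda theta : O) (T : set O)
    (J : O -> set (set O)) (C : O -> set O)
    (hkappa : regular_uncountable kappa)
    (hlambda : infinite_cardinal lambda) (hlk : lambda < kappa)
    (htheta : cardinal theta)
    (hT : stationary kappa T) (hTlim : forall a, T a -> limit a)
    (hJ : forall delta, Ecf kappa lambda delta ->
       [/\ proper_ideal delta (J delta), complete lambda (J delta) &
           Jbd delta `<=` J delta])
    (hC : bounded_C_sequence (Ecf kappa lambda) lambda C)
    (hguess : forall D, club kappa D ->
       exists2 delta, Ecf kappa lambda delta &
         positive delta (J delta)
           [set beta | beta < delta /\
              (D `&` T) (omin (C delta `\` [set x | x <= beta]))])
    (hcases :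
       [\/ [/\ theta = lambda, lt_sequences lambda #= pre lambda &
               successor_cardinal lambda],
           [/\ theta = lambda, diamond lambda & ~ Mahlo lambda],
           [/\ theta = lambda, diamond_star lambda &
               forall delta, Ecf kappa lambda delta -> normal delta (J delta)]
         | [/\ theta < lambda, regular theta & ~ greatly_Mahlo lambda]]) :
  exists h : O -> O, (forall i, i < lambda -> h i < theta) /\
    forall D, club kappa D ->
      exists2 delta, Ecf kappa lambda delta &
        forall tau, tau < theta ->
          positive delta (J delta)
            [set beta | [/\ beta < delta,
               h (otp (C delta `&` pre beta)) = tau &
               (D `&` T) (omin (C delta `\` [set x | x <= beta]))]].
Proof.
have rl : regular lambda := lambda_regular wfO hkappa hlambda hC hguess.
have sl : small kappa (pre lambda) := small_pre wfO hkappa.1 hlk.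
case: hcases => [[-> ls sc]|[-> dl nM]|[-> dl nJ]|[thl rth nG]].
- have [mu mul [c [cl cP]]] := successor_coloring wfO hlambda ls sc.
  apply: (reduction wfO hkappa hJ hC hguess (W := pre mu) (c := c)) => //.
    by apply: (small_pre wfO hkappa.1); exact: lt_trans hlk.
  by move=> I gI _; exact: cP.
- have [c [cl cP]] := diamond_coloring wfO dl nM.
  apply: (reduction wfO hkappa hJ hC hguess (W := pre lambda) (c := c)) => //.
  by move=> I gI _; exact: cP.
- have [c [cl cP]] := diamond_star_coloring wfO dl.
  apply: (reduction wfO hkappa hJ hC hguess (W := pre lambda) (c := c)) => //.
  by move=> I gI nI; apply: cP => //; exact: nI.
have [P [W [c [sW cth cP]]]] := not_greatly_Mahlo_coloring wfO hkappa hlk rl rth thl nG.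
apply: (reduction wfO hkappa hJ hC hguess sW (c := c)) => //.
by move=> I gI _; exact: cP.
Qed.
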